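(* Let $n\ge1$ and $d,r_1,r_2$ be integers with $r_1\ge d$, $r_2\ge d$ and $d\ge3$. If $n<d^2-3d+2$, then the scheme representing $\mathrm{Bilin}_{d,d,d}^{r_1,r_2}(\mathbb{A}^n)$ is reducible.
   Context: Let $k$ be an infinite algebraically closed field, $S=k[x_1,\dots,x_n]$, $\mathbb{A}^n=\operatorname{Spec}S$, $S_A=S\otimes_kA$ for a $k$-algebra $A$. The functor $\mathrm{Bilin}_{d,d,d}^{r_1,r_2}(\mathbb{A}^n)\colon(\mathrm{Sch}/k)^{op}\to\mathrm{Set}$ is given on affine schemes $\operatorname{Spec}A$ by the set of triples $[p_1,p_2,\pi]$ of $S_A$-linear surjections $p_i\colon S_A^{\oplus r_i}\twoheadrightarrow M_i$ ($i=1,2$) and $\pi\colon M_1\otimes_{S_A}M_2\twoheadrightarrow M_3$ with $M_j$ locally free of rank $d$ over $A$ ($j=1,2,3$), surjections with equal kernels being identified (and analogously with quasicoherent sheaves over an arbitrary $k$-scheme). It is representable by a $k$-scheme, a closed subscheme of a product of Quot schemes of points. Reducible means that the underlying topological space of the representing scheme is not irreducible. *)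

(* Defs.v *)
From HB Require Import structures.
From mathcomp Require Import all_boot all_algebra.
From mathcomp Require Import sesquilinear mpoly.
From mathcomp Require Import boolp classical_sets topology_structure.

Set Implicit Arguments.
Unset Strict Implicit.
Unset Printing Implicit Defensive.

Import GRing.Theory.
Local Open Scope classical_set_scope.
Local Open Scope ring_scope.

Definition irreducible_space (X : topologicalType) : Prop :=
  [set: X] !=set0 /\
  forall F G : set X, closed F -> closed G ->
    F `|` G = [set: X] -> F = [set: X] \/ G = [set: X].

Definition prime_ideal (R : comPzRingType) (P : set R) : Prop :=
  [/\ P 0, forall a b, P a -> P b -> P (a + b), forall a b, P b -> P (a * b),
      ~ P 1 & forall a b, P (a * b) -> P a \/ P b].

Record opens (X : topologicalType) := Opens {
  oset :> set X;
  oset_open : open oset }.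

Definition full (X : topologicalType) : opens X := Opens (@openT X).

Definition preim (X Y : topologicalType) (f : X -> Y) (fc : continuous f)
  (V : opens Y) : opens X :=
  Opens (proj1 (continuousP f) fc V (oset_open V)).

(* Sections over an open set may form the zero ring (as they do over the empty
   set), hence [comPzRingType]. *)
Record ringedSpace := RingedSpace {
  points :> topologicalType;
  sec : opens points -> comPzRingType;
  res : forall U V : opens points, V `<=` U -> {rmorphism sec U -> sec V};
  res_id : forall (U : opens points) (h : U `<=` U) (s : sec U), res h s = s;
  res_trans : forall (U V W : opens points)
    (h : V `<=` U) (g : W `<=` V) (f : W `<=` U) (s : sec U),
    res g (res h s) = res f s;
  glue : forall (U : opens points) (I : Type) (V : I -> opens points)
    (h : forall i, V i `<=` U),
    (forall x, oset U x -> exists i, oset (V i) x) ->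
    forall s : (forall i, sec (V i)),
    (forall i j (W : opens points) (hi : W `<=` V i) (hj : W `<=` V j),
       res hi (s i) = res hj (s j)) ->
    exists! t : sec U, forall i, res (h i) t = s i }.

(* For x in U: the germ of s at x is a unit of the stalk at x. *)
Definition inv_at (X : ringedSpace) (x : X) (U : opens X) (s : sec U) : Prop :=
  exists (V : opens X) (h : V `<=` U) (t : sec V), oset V x /\ t * res h s = 1.

(* All stalks are local rings: nonzero, and if a sum of two elements is a unit
   then so is one of the two (any two germs at x live on a common U). *)
Definition locally_ringed (X : ringedSpace) : Prop :=
  forall (x : X) (U : opens X), oset U x ->
    ~ inv_at x (0 : sec U) /\
    forall s t : sec U, inv_at x (s + t) -> inv_at x s \/ inv_at x t.

(* For X locally ringed, the ringed space (U, O_X|U) is isomorphic to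
   Spec O_X(U), via x |-> {s | s vanishes at x}.  Spelled out: this map is a
   bijection onto the prime ideals of O_X(U); the sets D(s), s in O_X(U), form
   a basis of the topology of U; and O_X(D(s)) is the localization of O_X(U)
   away from s.  ([s] is automatically invertible in O_X(D(s)).) *)
Definition affine_open (X : ringedSpace) (U : opens X) : Prop :=
  [/\ forall P : set (sec U), prime_ideal P ->
        exists! x : X, oset U x /\ P = [set s | ~ inv_at x s],
      forall (V : opens X) (x : X), V `<=` U -> oset V x ->
        exists s : sec U, inv_at x s /\
          forall y, oset U y -> inv_at y s -> oset V y &
      forall (s : sec U) (D : opens X) (h : D `<=` U),
        (forall x, oset D x <-> oset U x /\ inv_at x s) ->
        (forall t : sec D, exists (m : nat) (a : sec U),
           res h (s ^+ m) * t = res h a) /\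
        (forall a : sec U, res h a = 0 -> exists m : nat, s ^+ m * a = 0)].

(* A k-scheme X; the morphism X -> Spec k is given by k -> Gamma(X, O_X). *)
Record scheme (k : fieldType) := Scheme {
  ringed :> ringedSpace;
  scheme_lr : locally_ringed ringed;
  scheme_affine : forall x : ringed,
    exists U : opens ringed, oset U x /\ affine_open U;
  str : {rmorphism k -> sec (full ringed)} }.

Record hom (k : fieldType) (X Y : scheme k) := Hom {
  hfun :> X -> Y;
  hcont : continuous hfun;
  sharp : forall V : opens Y, {rmorphism sec V -> sec (preim hcont V)};
  sharp_res : forall (V W : opens Y) (h : W `<=` V)
    (h' : preim hcont W `<=` preim hcont V) (s : sec V),
    sharp W (res h s) = res h' (sharp V s);
  sharp_local : forall (x : X) (V : opens Y) (s : sec V), oset V (hfun x) ->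
    inv_at x (sharp V s) -> inv_at (hfun x) s;
  sharp_str : forall (h : full X `<=` preim hcont (full Y)) (c : k),
    res h (sharp (full Y) (str Y c)) = str X c }.

Arguments hcont {k X Y} h : rename.

Section Composition.
Variables (k : fieldType) (X Y Z : scheme k) (psi : hom Y Z) (phi : hom X Y).

Lemma comp_cont : continuous (psi \o phi).
Proof.
by move=> x; apply: continuous_comp; exact: hcont.
Qed.

Lemma comp_sub (V : opens Z) :
  preim comp_cont V `<=` preim (hcont phi) (preim (hcont psi) V).
Proof. by []. Qed.

Definition comp_sharp (V : opens Z) :
    {rmorphism sec V -> sec (preim comp_cont V)} :=
  res (@comp_sub V) \o (sharp phi (preim (hcont psi) V) \o sharp psi V).

Lemma inv_at_res (T : ringedSpace) (x : T) (U V : opens T) (h : V `<=` U)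
  (s : sec U) : inv_at x (res h s) -> inv_at x s.
Proof.
move=> [W [g [t [Wx e]]]]; exists W, (subset_trans g h), t; split=> //.
by rewrite -e (res_trans _ _ (subset_trans g h)).
Qed.

Lemma comp_sharp_res (V W : opens Z) (h : W `<=` V)
  (h' : preim comp_cont W `<=` preim comp_cont V) (s : sec V) :
  comp_sharp W (res h s) = res h' (comp_sharp V s).
Proof.
have g : preim (hcont psi) W `<=` preim (hcont psi) V by move=> y; apply: h.
have g' : preim (hcont phi) (preim (hcont psi) W) `<=`
          preim (hcont phi) (preim (hcont psi) V) by move=> y; apply: h.
have f : preim comp_cont W `<=` preim (hcont phi) (preim (hcont psi) V).
  by move=> y; apply: h.
by rewrite /= (sharp_res h g) (sharp_res g g') !(res_trans _ _ f).
Qed.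

Lemma comp_sharp_local (x : X) (V : opens Z) (s : sec V) :
  oset V ((psi \o phi) x) -> inv_at x (comp_sharp V s) ->
  inv_at ((psi \o phi) x) s.
Proof.
move=> Vx /inv_at_res i; apply: (sharp_local Vx).
exact: (sharp_local (V := preim (hcont psi) V) Vx).
Qed.

Lemma comp_sharp_str (h : full X `<=` preim comp_cont (full Z)) (c : k) :
  res h (comp_sharp (full Z) (str Z c)) = str X c.
Proof.
have fY : full Y `<=` preim (hcont psi) (full Z) by [].
have fX : full X `<=` preim (hcont phi) (full Y) by [].
have g : preim (hcont phi) (full Y) `<=`
         preim (hcont phi) (preim (hcont psi) (full Z)) by [].
have e : full X `<=` preim (hcont phi) (preim (hcont psi) (full Z)) by [].
rewrite -(sharp_str fX) -(sharp_str fY) (sharp_res fY g).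
by rewrite /= !(res_trans _ _ e).
Qed.

Definition comp_hom : hom X Z :=
  Hom comp_sharp_res comp_sharp_local comp_sharp_str.

End Composition.

(* An identification of the k-scheme T with Spec A. *)
Record spec_of (k : fieldType) (A : comAlgType k) (T : scheme k) := SpecOf {
  spec_affine : affine_open (full T);
  spec_iso :> {rmorphism A -> sec (full T)};
  spec_bij : bijective spec_iso;
  spec_str : forall c : k, spec_iso c%:A = str T c }.

(* A set-valued functor F on affine k-schemes is given by a type F A of
   representatives of the elements of F(Spec A), a relation [eqF] of
   representing the same element, and a relation [pullF f x y], to be read
   "y represents the restriction of x along Spec f".  X represents F if there
   is a bijection Hom_k(Spec A, X) -> F(Spec A), natural in Spec A.
   A k-scheme is determined by its points in affine schemes.  Only nonzero
   k-algebras are considered, as in [comAlgType]: all functors at stake take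
   Spec 0, the empty scheme, to a singleton. *)
Definition represents (k : fieldType) (X : scheme k)
  (F : comAlgType k -> Type)
  (eqF : forall A, F A -> F A -> Prop)
  (pullF : forall A B : comAlgType k, {lrmorphism A -> B} -> F A -> F B -> Prop)
  : Prop :=
  exists Phi : (forall (A : comAlgType k) (T : scheme k),
                  spec_of A T -> hom T X -> F A),
  [/\ forall A T (i : spec_of A T) (u v : hom T X),
        eqF A (Phi A T i u) (Phi A T i v) -> u = v,
      forall A T (i : spec_of A T) (x : F A),
        exists u : hom T X, eqF A (Phi A T i u) x &
      forall A B T T' (i : spec_of A T) (j : spec_of B T')
        (f : {lrmorphism A -> B}) (g : hom T' T)
        (h : full T' `<=` preim (hcont g) (full T)),
        (forall a : A, res h (sharp g (full T) (i a)) = j (f a)) ->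
        forall u : hom T X,
          pullF A B f (Phi A T i u) (Phi B T' j (comp_hom u g))].

(* M' = M (x)_R R', through g. *)
Definition is_base_change (R R' : nzRingType) (phi : {rmorphism R -> R'})
  (M : lmodType R) (M' : lmodType R') (g : {linear M -> M' | phi \; *:%R}) :=
  forall (N : lmodType R') (h : {linear M -> N | phi \; *:%R}),
  exists h' : {linear M' -> N}, (forall m, h' (g m) = h m) /\
    forall h'' : {linear M' -> N}, (forall m, h'' (g m) = h m) -> h'' =1 h'.

(* M is locally free of rank d as an A-module: every point of Spec A has a
   basic open neighbourhood D(a) such that M_a is free of rank d over A_a.  A
   basis of M_a can be rescaled by a power of a so as to consist of images of
   elements e_i of M; the two conditions say that these images generate M_a
   and are linearly independent over A_a. *)
Definition locally_free (A : comNzRingType) (n d : nat)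
  (M : lmodType {mpoly A[n]}) : Prop :=
  forall P : set A, prime_ideal P ->
  exists (a : A) (e : 'I_d -> M), [/\ ~ P a,
    forall m : M, exists (N : nat) (c : 'I_d -> A),
      (a ^+ N)%:MP *: m = \sum_(i < d) (c i)%:MP *: e i &
    forall c : 'I_d -> A, \sum_(i < d) (c i)%:MP *: e i = 0 ->
      exists N : nat, forall i, a ^+ N * c i = 0].

(* Triples (p1, p2, p3) over A, with S_A = {mpoly A[n]}.  A linear map out of
   M1 (x) M2 is a bilinear map; a general element of M1 (x) M2 is a finite sum
   of elementary tensors, and its image is the sum of the values of [p3]. *)
Record bilin (n d r1 r2 : nat) (A : comNzRingType) := BilinTriple {
  M1 : lmodType {mpoly A[n]};
  M2 : lmodType {mpoly A[n]};
  M3 : lmodType {mpoly A[n]};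
  p1 : {linear 'rV[{mpoly A[n]}]_r1 -> M1};
  p2 : {linear 'rV[{mpoly A[n]}]_r2 -> M2};
  p3 : {bilinear M1 -> M2 -> M3};
  M1_free : locally_free d M1;
  M2_free : locally_free d M2;
  M3_free : locally_free d M3;
  p1_surj : forall m, exists u, p1 u = m;
  p2_surj : forall m, exists u, p2 u = m;
  p3_surj : forall m, exists (N : nat) (u : 'I_N -> M1) (v : 'I_N -> M2),
    \sum_(i < N) p3 (u i) (v i) = m }.

(* Equality of kernels; once ker p_i = ker p_i', both M1 (x) M2 and
   M1' (x) M2' are the same quotient of S_A^r1 (x) S_A^r2. *)
Definition bilin_eq (n d r1 r2 : nat) (A : comNzRingType)
  (x y : bilin n d r1 r2 A) : Prop :=
  [/\ forall u, p1 x u = 0 <-> p1 y u = 0,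
      forall v, p2 x v = 0 <-> p2 y v = 0 &
      forall (N : nat) (u : 'I_N -> 'rV_r1) (v : 'I_N -> 'rV_r2),
        \sum_(i < N) p3 x (p1 x (u i)) (p2 x (v i)) = 0 <->
        \sum_(i < N) p3 y (p1 y (u i)) (p2 y (v i)) = 0].

(* y is the restriction of x along Spec f: its modules are
   M_j (x)_A B = M_j (x)_{S_A} S_B, with the induced surjections. *)
Definition bilin_pull (n d r1 r2 : nat) (A B : comNzRingType)
  (f : {rmorphism A -> B}) (x : bilin n d r1 r2 A) (y : bilin n d r1 r2 B)
  : Prop :=
  let F : {rmorphism {mpoly A[n]} -> {mpoly B[n]}} := map_mpoly f in
  exists (g1 : {linear M1 x -> M1 y | F \; *:%R})
         (g2 : {linear M2 x -> M2 y | F \; *:%R})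
         (g3 : {linear M3 x -> M3 y | F \; *:%R}),
  [/\ is_base_change g1, is_base_change g2 & is_base_change g3] /\
  [/\ forall u, g1 (p1 x u) = p1 y (map_mx F u),
      forall v, g2 (p2 x v) = p2 y (map_mx F v) &
      forall u v, g3 (p3 x u v) = p3 y (g1 u) (g2 v)].

Definition represents_bilin (k : fieldType) (n d r1 r2 : nat) (X : scheme k)
  : Prop :=
  @represents k X (fun A => bilin n d r1 r2 A)
    (fun A => @bilin_eq n d r1 r2 A)
    (fun A B f => @bilin_pull n d r1 r2 A B f).

(* Main.v *)
From HB Require Import structures.
From mathcomp Require Import all_boot all_algebra.
From mathcomp Require Import sesquilinear mpoly.
From mathcomp Require Import boolp classical_sets functions topology_structure.
From mathcomp Require Import ring.
Require Import Defs.

(** For a triple with generators e_i = p1 (delta_i) of M1, write T(a, v) for the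
    value of p3 on a in M1 and v in M2. The scheme X is reducible because two
    conditions on a triple define disjoint nonempty open subsets of it:

    - [cyclic]: M1 is generated by e_0 as a module over the polynomial ring S;
    - [noncomm_onto]: T(e_0, -) is onto, and for some f the equations
      T(e_1, f) = T(e_0, w) and T(e_2, f) = T(e_0, w') have solutions with
      T(e_2, w) <> T(e_1, w').

    They exclude each other over a field ([cyclic_not_noncommuting]). If
    e_i = s_i e_0 with s_i in S, then T(e_i, v) = T(e_0, s_i v). The map
    T(e_0, -) goes from M2 onto M3, which have the same dimension, so it is also
    injective; the two equations then give w = s_1 f and w' = s_2 f, and both
    T(e_2, w) and T(e_1, w') equal T(e_0, s_1 s_2 f).

    Both occur over k. Multiplication on k[t]/(t^d), with the variables acting
    as t, is cyclic. On M1 = M2 = M3 = k^d with the variables acting by zero the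
    tensor is arbitrary; as d >= 3, its first three slices can be the identity
    and two matrix units that do not commute.

    Both are open ([open_locus]). Near the k-point of X that represents a given
    triple, the inclusion of an affine open subscheme U represents a universal
    triple over A = O_X(U), whose restriction to any field-valued point of U is
    the triple which that point represents ([universal_family]). Surjectivity
    and nonvanishing at one point of U persist on some basic open set D(h):
    [spread_submodule] is Nakayama's lemma by the determinant trick, and
    [spread_nonzero] looks at coordinates in a local basis.

    If X were irreducible, the two open sets would share a point, perhaps not a
    closed one. The spectrum of its residue field maps to X
    ([ex_residue_point]), and the triple represented by that map would satisfy
    both conditions. *)

Set Implicit Arguments.
Unset Strict Implicit.
Unset Printing Implicit Defensive.

Import GRing.Theory.
Local Open Scope classical_set_scope.
Local Open Scope ring_scope.
Local Open Scope quotient_scope.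

(** * Extensionality of open sets and of morphisms of schemes *)

Lemma opens_ext (X : topologicalType) (U V : opens X) :
  (forall x, oset U x <-> oset V x) -> U = V.
Proof.
case: U V => [U oU] [V oV] /= UV.
have e : U = V by apply/seteqP; split=> x /UV.
by case: _ / e oV => oV; congr Opens; exact: Prop_irrelevance.
Qed.

Lemma rmorphism_ext (R S : pzSemiRingType) (f g : {rmorphism R -> S}) :
  f =1 g -> f = g.
Proof.
case: f g => [f [[hf0] [hf1]]] [g [[hg0] [hg1]]] /= fg.
have e : f = g by apply/funext.
case: _ / e hg0 hg1 => ? ?.
congr GRing.RMorphism.Pack; congr GRing.RMorphism.Class.
  congr GRing.isNmodMorphism.phant_Build; exact: Prop_irrelevance.
congr GRing.isMonoidMorphism.phant_Build; exact: Prop_irrelevance.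
Qed.

(** The maps on sections of the two morphisms live over preimages that agree
    only propositionally, so their comparison goes through a restriction map. *)
Lemma hom_ext (k : fieldType) (X Y : scheme k) (phi psi : hom X Y) :
  (forall x, phi x = psi x) ->
  (forall (V : opens Y)
     (h : preim (hcont phi) V `<=` preim (hcont psi) V) (s : sec V),
     sharp phi V s = res h (sharp psi V s)) ->
  phi = psi.
Proof.
case: phi => f fc fs fr fl ft; case: psi => g gc gs gr gl gt /= fg sfg.
have e : f = g by apply/funext.
case: _ / e gc gs gr gl gt sfg {fg} => gc.
rewrite (Prop_irrelevance gc fc) => gs gr gl gt sfg.
have e : fs = gs.
  apply: functional_extensionality_dep => V; apply: rmorphism_ext => s.
  by rewrite (sfg V (fun _ => id)) res_id.
case: _ / e gr gl gt {sfg} => gr gl gt.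
by congr Hom; exact: Prop_irrelevance.
Qed.

(** * The spectrum of a field *)

(** On a one-point space the sections over V can be taken to be all functions
    from V to K: this gives K over the point and the zero ring over the empty
    set with no case distinction. *)
Definition pt : Type := unit.
HB.instance Definition _ := Choice.on pt.

Lemma pt_opI : setI_closed [set: set pt]. Proof. by []. Qed.
Lemma pt_op_bigU (I : Type) (f : I -> set pt) :
  (forall i, [set: set pt] (f i)) -> [set: set pt] (\bigcup_i f i).
Proof. by []. Qed.
HB.instance Definition _ := isOpenTopological.Build pt I pt_opI pt_op_bigU.

Section Restriction.
Variables (S T : Type) (K : pzRingType) (h : S -> T).
Definition pullback (f : T -> K) : S -> K := f \o h.
Lemma pullback_nmod : nmod_morphism pullback.
Proof. by split=> [|f g]; apply/funext. Qed.
Lemma pullback_monoid : monoid_morphism pullback.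
Proof. by split=> [|f g]; apply/funext. Qed.
HB.instance Definition _ :=
  GRing.isNmodMorphism.Build (T -> K) (S -> K) pullback pullback_nmod.
HB.instance Definition _ :=
  GRing.isMonoidMorphism.Build (T -> K) (S -> K) pullback pullback_monoid.
End Restriction.

Section PointScheme.
Variables (k K : fieldType) (phi : {rmorphism k -> K}).

Definition pt_sec (V : opens pt) : comPzRingType := {x : pt | oset V x} -> K.

Definition pt_incl (U V : opens pt) (h : V `<=` U) (x : {x | oset V x}) :
  {x | oset U x} := exist _ (sval x) (h _ (svalP x)).

Definition pt_res (U V : opens pt) (h : V `<=` U) :
  {rmorphism pt_sec U -> pt_sec V} := @pullback _ _ K (pt_incl h).

Lemma pt_res_id (U : opens pt) (h : U `<=` U) (s : pt_sec U) :
  pt_res h s = s.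
Proof.
by apply/funext => -[x Ux]; congr (s (exist _ _ _)); exact: Prop_irrelevance.
Qed.

Lemma pt_res_trans (U V W : opens pt) (h : V `<=` U) (g : W `<=` V)
  (f : W `<=` U) (s : pt_sec U) : pt_res g (pt_res h s) = pt_res f s.
Proof.
by apply/funext => -[x Ux]; congr (s (exist _ _ _)); exact: Prop_irrelevance.
Qed.

Lemma pt_glue (U : opens pt) (I : Type) (V : I -> opens pt)
  (h : forall i, V i `<=` U) :
  (forall x, oset U x -> exists i, oset (V i) x) ->
  forall s : (forall i, pt_sec (V i)),
  (forall i j (W : opens pt) (hi : W `<=` V i) (hj : W `<=` V j),
     pt_res hi (s i) = pt_res hj (s j)) ->
  exists! t : pt_sec U, forall i, pt_res (h i) t = s i.
Proof.
move=> cov s cmp.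
have irr j z (p q : oset (V j) z) : s j (exist _ z p) = s j (exist _ z q).
  by rewrite (Prop_irrelevance p q).
have [c cP] := choice (fun x : {x | oset U x} => cov (sval x) (svalP x)).
exists (fun x => s (c x) (exist _ (sval x) (cP x))); split=> [i|t tP].
  apply/funext => -[x Vx]; pose y := pt_incl (h i) (exist _ x Vx).
  pose Vcx : oset (V (c y)) x := cP y.
  have Wo : open (V i `&` V (c y)) by [].
  have := cmp i (c y) (Opens Wo) (@subIsetl _ _ _) (@subIsetr _ _ _).
  move/(congr1 (@^~ (exist _ x (conj Vx Vcx)))) => /=.
  rewrite /pullback /= /pt_incl /= => e.
  change (s (c y) (exist _ x Vcx) = s i (exist _ x Vx)).
  exact: etrans (irr _ _ _ _) (etrans (esym e) (irr _ _ _ _)).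
apply/funext => -[x Ux] /=.
set y := exist _ _ _ : {x | oset U x}.
rewrite -(tP (c y)) /=.
by congr (t (exist _ _ _)); exact: Prop_irrelevance.
Qed.

Definition pt_rs : ringedSpace :=
  @RingedSpace pt pt_sec pt_res pt_res_id pt_res_trans pt_glue.

Lemma pt_inv_atP (x : pt_rs) (U : opens pt_rs) (Ux : oset U x) (s : sec U) :
  inv_at x s <-> s (exist _ x Ux) != 0.
Proof.
split=> [[V [h [t [Vx e]]]]|sx0].
  move: (congr1 (@^~ (exist _ x Vx)) e).
  change (t (exist _ x Vx) * s (pt_incl h (exist _ x Vx)) = 1 ->
    s (exist _ x Ux) != 0).
  have -> : pt_incl h (exist _ x Vx) = exist _ x Ux.
    by congr exist; exact: Prop_irrelevance.
  by move=> e1; apply: contra_eq_neq e1 => ->; rewrite mulr0 eq_sym oner_neq0.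
exists U, (@subset_refl _ _), (fun y => (s y)^-1); split=> //.
rewrite pt_res_id; apply/funext => -[[] Uy].
change ((s (exist _ tt Uy))^-1 * s (exist _ tt Uy) = 1).
case: x Ux sx0 => Ux; rewrite (Prop_irrelevance Ux Uy); exact: mulVf.
Qed.

Lemma pt_lr : locally_ringed pt_rs.
Proof.
move=> x U Ux; split=> [/(pt_inv_atP Ux)|s t /(pt_inv_atP Ux) st].
  by rewrite eqxx.
have [s0|s0] := eqVneq (s (exist _ x Ux)) 0.
  right; apply/(pt_inv_atP Ux); move: st.
  by rewrite /GRing.add /= s0 add0r.
by left; apply/(pt_inv_atP Ux).
Qed.

Lemma pt_eq (U : opens pt_rs) (s t : sec U) :
  (forall Ux : oset U tt, s (exist _ tt Ux) = t (exist _ tt Ux)) -> s = t.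
Proof. by move=> e; apply/funext => -[[] Ux]; exact: e. Qed.

Lemma pt_affine : affine_open (full pt_rs).
Proof.
have pI : oset (full pt_rs) tt by [].
split.
- move=> P [P0 PD PM P1 _]; exists (tt : pt_rs); split=> [|[]//]; split=> //.
  have invP (s : sec (full pt_rs)) :
      ~ inv_at (tt : pt_rs) s <-> s (exist _ tt pI) = 0.
    split=> [ns|s0 /(pt_inv_atP pI)]; last by rewrite s0 eqxx.
    by apply/eqP/negPn/negP => /(pt_inv_atP pI).
  apply/seteqP; split=> s /=; rewrite invP; last first.
    by move=> s0; rewrite [s](_ : _ = 0) //; apply: pt_eq => Ux;
       rewrite (Prop_irrelevance Ux pI).
  move=> Ps.
  apply/eqP; apply/negPn/negP => s0; apply: P1.
  have := PM (fun=> (s (exist _ tt pI))^-1) s Ps.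
  congr P; apply: pt_eq => Ux; rewrite /GRing.mul /= (Prop_irrelevance Ux pI).
  exact: mulVf.
- move=> V x h Vx; exists 1; split.
    by apply/(@pt_inv_atP _ (full pt_rs) I); exact: oner_neq0.
  by case: x Vx => Vx [].
- move=> s D h DP; split=> [t|a ha].
    exists 0%N; have [Dx|nD] := pselect (oset D tt).
      exists (fun=> t (exist _ tt Dx)).
      rewrite expr0 rmorph1 mul1r; apply: pt_eq => Ux.
      by rewrite (Prop_irrelevance Ux Dx).
    by exists 0; apply: pt_eq => Ux; case: nD.
  have [Dx|nD] := pselect (oset D tt).
    exists 0%N; rewrite expr0 mul1r; apply: pt_eq => Ux.
    move: (congr1 (@^~ (exist _ tt Dx)) ha); congr (_ = _); congr a.
    by congr exist; exact: Prop_irrelevance.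
  exists 1%N; apply: pt_eq => Ux.
  have [s0|s0] := eqVneq (s (exist _ tt Ux)) 0.
    by rewrite expr1 /GRing.mul /= s0 mul0r.
  case: nD; apply/DP; split=> //; exact/pt_inv_atP.
Qed.

Definition pt_str (c : k) : sec (full pt_rs) := fun=> phi c.
Lemma pt_str_nmod : nmod_morphism pt_str.
Proof.
by split=> [|a b]; apply/funext => x; rewrite /pt_str ?rmorph0 ?rmorphD.
Qed.
Lemma pt_str_monoid : monoid_morphism pt_str.
Proof.
by split=> [|a b]; apply/funext => x; rewrite /pt_str ?rmorph1 ?rmorphM.
Qed.
HB.instance Definition _ :=
  GRing.isNmodMorphism.Build k (sec (full pt_rs)) pt_str pt_str_nmod.
HB.instance Definition _ :=
  GRing.isMonoidMorphism.Build k (sec (full pt_rs)) pt_str pt_str_monoid.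

Lemma pt_has_affine (x : pt_rs) :
  exists U : opens pt_rs, oset U x /\ affine_open U.
Proof. by exists (full pt_rs); split=> //; exact: pt_affine. Qed.

Definition pt_scheme : scheme k := Scheme pt_lr pt_has_affine pt_str.

End PointScheme.

(** * Algebras given by a structure map *)

(** A copy of R that carries the k-algebra structure defined by [phi]; the
    sections over an affine open set and the residue fields get theirs this
    way. *)
Definition algebra_of (k : fieldType) (R : comPzRingType) (nz : 1 != 0 :> R)
  (phi : k -> R) : Type := R.

Section AlgebraOf.
Variables (k : fieldType) (R : comPzRingType) (nz : 1 != 0 :> R).
Variable (phi : {rmorphism k -> R}).
Local Notation B := (algebra_of nz phi).
HB.instance Definition _ := GRing.ComPzRing.on B.
HB.instance Definition _ := GRing.PzSemiRing_isNonZero.Build B nz.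
Definition alg_scale (c : k) (b : B) : B := (phi c : B) * b.
Lemma alg_scaleA a b v : alg_scale a (alg_scale b v) = alg_scale (a * b) v.
Proof. by rewrite /alg_scale rmorphM mulrA. Qed.
Lemma alg_scale1 : left_id 1 alg_scale.
Proof. by move=> v; rewrite /alg_scale rmorph1 mul1r. Qed.
Lemma alg_scaleDr : right_distributive alg_scale +%R.
Proof. by move=> a u v; rewrite /alg_scale mulrDr. Qed.
Lemma alg_scaleDl v : {morph alg_scale^~ v : a b / a + b}.
Proof. by move=> a b; rewrite /alg_scale rmorphD mulrDl. Qed.
HB.instance Definition _ := GRing.Zmodule_isLmodule.Build k B
  alg_scaleA alg_scale1 alg_scaleDr alg_scaleDl.
Lemma alg_scaleAl (a : k) (u v : B) : a *: (u * v) = a *: u * v.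
Proof. exact: mulrA. Qed.
HB.instance Definition _ := GRing.Lmodule_isLalgebra.Build k B alg_scaleAl.
HB.instance Definition _ := GRing.Lalgebra_isComAlgebra.Build k B.

Lemma algebra_ofE (c : k) : c%:A = phi c :> B.
Proof. exact: mulr1. Qed.

Lemma spec_of_algebra (T : scheme k) (f : {rmorphism R -> sec (full T)}) :
  affine_open (full T) -> bijective f -> (forall c, f (phi c) = str T c) ->
  spec_of B T.
Proof.
move=> aff bij fs.
refine (@SpecOf k B T aff (f : {rmorphism B -> sec (full T)}) bij _) => c.
by rewrite algebra_ofE.
Defined.
End AlgebraOf.

Section PointSpec.
Variables (k K : fieldType) (phi : {rmorphism k -> K}).
Local Notation T := (pt_scheme phi).
Definition pt_const (b : K) : sec (full T) := fun=> b.
Lemma pt_const_nmod : nmod_morphism pt_const. Proof. by []. Qed.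
Lemma pt_const_monoid : monoid_morphism pt_const. Proof. by []. Qed.
HB.instance Definition _ :=
  GRing.isNmodMorphism.Build K (sec (full T)) pt_const pt_const_nmod.
HB.instance Definition _ :=
  GRing.isMonoidMorphism.Build K (sec (full T)) pt_const pt_const_monoid.
Lemma pt_const_bij : bijective pt_const.
Proof.
exists (fun s : sec (full T) => s (exist _ tt I)) => [//|s].
by apply: pt_eq => Ux; rewrite /pt_const; congr (s (exist _ _ _)).
Qed.
Definition pt_spec : spec_of (algebra_of (oner_neq0 K) phi) T :=
  @spec_of_algebra k K (oner_neq0 K) phi T pt_const (@pt_affine K)
    pt_const_bij (fun=> erefl).
End PointSpec.

(** * Affine open subschemes *)

Definition sub_pt (X : topologicalType) (U : opens X) : Type :=
  {x : X | oset U x}.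

Section SubTopology.
Variables (X : topologicalType) (U : opens X).
Local Notation S := (sub_pt U).
HB.instance Definition _ := gen_eqMixin S.
HB.instance Definition _ := gen_choiceMixin S.

Lemma sub_inj : injective (sval : S -> X).
Proof.
move=> [x Ux] [y Uy] /= e; case: _ / e Uy => Uy.
by congr exist; exact: Prop_irrelevance.
Qed.

(** As U is open, a subset of U is open in the subspace topology exactly when it
    is open in X; with this form of the topology an open subset of U is at once
    an open subset of X. *)
Definition sub_op : set (set S) := [set A | open (sval @` A : set X)].
Lemma sub_opT : sub_op setT.
Proof.
rewrite /sub_op /=.
suff -> : sval @` [set: S] = U :> set X by exact: oset_open.
by apply/seteqP; split=> [_ [[x Ux] _ <-] //|x Ux]; exists (exist _ x Ux).
Qed.
Lemma sub_opI : setI_closed sub_op.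
Proof.
move=> A B oA oB; rewrite /sub_op /=.
have -> : sval @` (A `&` B) = (sval @` A) `&` (sval @` B) :> set X.
  apply/seteqP; split=> [_ [x [Ax Bx] <-]|_ [[x Ax <-] [y By /sub_inj e]]].
    by split; exists x.
  by exists x => //; split=> //; rewrite -e.
exact: openI.
Qed.
Lemma sub_op_bigU (I : Type) (f : I -> set S) :
  (forall i, sub_op (f i)) -> sub_op (\bigcup_i f i).
Proof.
move=> fo; rewrite /sub_op /= image_bigcup.
by apply: bigcup_open => i _; exact: fo.
Qed.
HB.instance Definition _ :=
  isOpenTopological.Build S sub_opT sub_opI sub_op_bigU.

Lemma sub_openP (A : set S) : open A <-> open (sval @` A : set X).
Proof. by []. Qed.

Definition img (V : opens S) : opens X := Opens (oset_open V : sub_op V).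

Lemma img_sub (V W : opens S) : W `<=` V -> img W `<=` img V.
Proof. by move=> h _ [x Wx <-]; exists x => //; exact: h. Qed.

Lemma img_subU (V : opens S) : img V `<=` U.
Proof. by move=> _ [[x Ux] _ <-]. Qed.

Lemma img_full : img (full S) = U.
Proof.
apply: opens_ext => x; split=> [/img_subU //|Ux].
by exists (exist _ x Ux).
Qed.

Lemma imgE (V : opens S) (x : S) : oset (img V) (sval x) <-> oset V x.
Proof. by split=> [[y Vy /sub_inj <-]|Vx] //; exists x. Qed.

Lemma sub_cont : continuous (sval : S -> X).
Proof.
apply/continuousP => A oA; apply/sub_openP.
have -> : sval @` (sval @^-1` A : set S) = A `&` U :> set X.
  apply/seteqP; split=> [_ [[x Ux] Ax <-] //|x [Ax Ux]].
  by exists (exist _ x Ux).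
by apply: openI => //; exact: oset_open.
Qed.
End SubTopology.

Section OpenSubscheme.
Variables (k : fieldType) (X : scheme k) (U : opens X).
Hypothesis Uaff : affine_open U.

Definition sub_sec (V : opens (sub_pt U)) : comPzRingType := sec (img V).
Definition sub_res (V W : opens (sub_pt U)) (h : W `<=` V) :
  {rmorphism sub_sec V -> sub_sec W} := res (img_sub h).
Lemma sub_res_id (V : opens (sub_pt U)) (h : V `<=` V) (s : sub_sec V) :
  sub_res h s = s.
Proof. exact: res_id. Qed.
Lemma sub_res_trans (V W Z : opens (sub_pt U))
    (h : W `<=` V) (g : Z `<=` W) (f : Z `<=` V) (s : sub_sec V) :
    sub_res g (sub_res h s) = sub_res f s.
Proof. exact: res_trans. Qed.

Lemma sub_glue (W : opens (sub_pt U)) (I : Type) (V : I -> opens (sub_pt U))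
  (h : forall i, V i `<=` W) :
  (forall x, oset W x -> exists i, oset (V i) x) ->
  forall s : (forall i, sub_sec (V i)),
  (forall i j (Z : opens (sub_pt U)) (hi : Z `<=` V i) (hj : Z `<=` V j),
     sub_res hi (s i) = sub_res hj (s j)) ->
  exists! t : sub_sec W, forall i, sub_res (h i) t = s i.
Proof.
move=> cov s cmp; apply: glue => [_ [x Wx <-]|i j Z hi hj].
  by have [i Vx] := cov _ Wx; exists i; exists x.
(* The part of Z inside U: the compatibility of [s] is only known there. *)
pose Z' := preim (@sub_cont _ U) Z.
have hi' : Z' `<=` V i by move=> x /hi /imgE.
have hj' : Z' `<=` V j by move=> x /hj /imgE.
have ZZ' : Z `<=` img Z'.
  by move=> x Zx; exists (exist _ x (img_subU (hi _ Zx))).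
have := congr1 (res ZZ') (cmp i j Z' hi' hj').
by rewrite /sub_res (res_trans _ _ hi) (res_trans _ _ hj).
Qed.

Definition sub_rs : ringedSpace :=
  @RingedSpace (sub_pt U) sub_sec sub_res sub_res_id sub_res_trans sub_glue.

Lemma sub_inv_at (x : sub_rs) (V : opens sub_rs) (s : sec V) :
  inv_at x s <-> @inv_at X (sval x) (img V) s.
Proof.
split=> [[W [h [t [Wx e]]]]|[W [h [t [Wx e]]]]].
  by exists (img W), (img_sub h), t; split=> //; exact/imgE.
pose W' : opens sub_rs := preim (@sub_cont _ U) W.
have h' : W' `<=` V by move=> y /h /imgE.
have WW' : img W' `<=` W by move=> _ [y Wy <-].
exists W', h', (res WW' t); split=> //.
rewrite -(rmorph1 (res WW')) -e rmorphM; congr (_ * _).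
by rewrite /= /sub_res; symmetry; apply: res_trans.
Qed.

Lemma sub_lr : locally_ringed sub_rs.
Proof.
move=> x V Vx.
have [n0 D] := scheme_lr (proj2 (imgE V x) Vx).
split=> [/sub_inv_at //|s t /sub_inv_at /D []]; first by left; exact/sub_inv_at.
by right; exact/sub_inv_at.
Qed.

Lemma sub_affine (V : opens sub_rs) :
  @affine_open X (img V) -> affine_open V.
Proof.
move=> [prm bas loc]; split.
- move=> P /prm [_ [[[x Vx <-] Px] uniq]]; exists x; split=> [|y [Vy Py]].
    split=> //; rewrite Px; apply/seteqP.
    by split=> s /= ns; apply: contra_not ns => /sub_inv_at.
  apply: sub_inj; apply: uniq; split; first exact/imgE.
  rewrite Py; apply/seteqP.
  by split=> s /= ns; apply: contra_not ns => /sub_inv_at.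
- move=> W x WV Wx.
  have [s [sx sW]] := bas _ _ (img_sub WV) (proj2 (imgE W x) Wx).
  exists s; split; first exact/sub_inv_at.
  by move=> y Vy /sub_inv_at sy; apply/imgE; apply: sW => //; exact/imgE.
- move=> s D h DP; apply: loc => x; split.
    by move=> [y /DP[Vy sy] <-]; split; [exact/imgE|exact/sub_inv_at].
  by move=> [[y Vy <-] sy]; apply/imgE/DP; split=> //; exact/sub_inv_at.
Qed.

Lemma sub_full_affine : affine_open (full sub_rs).
Proof. by apply: sub_affine; rewrite img_full. Qed.

Lemma sub_has_affine (x : sub_rs) :
  exists V : opens sub_rs, oset V x /\ affine_open V.
Proof. by exists (full sub_rs); split=> //; exact: sub_full_affine. Qed.

Lemma sub_full : img (full sub_rs) `<=` full X. Proof. by []. Qed.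

Definition sub_str : {rmorphism k -> sec (full sub_rs)} :=
  res sub_full \o str X.

Definition sub_scheme : scheme k := Scheme sub_lr sub_has_affine sub_str.

Definition sub_incl (x : sub_scheme) : X := sval x.
Lemma sub_incl_cont : continuous sub_incl. Proof. exact: sub_cont. Qed.

Lemma sub_incl_sub (V : opens X) : img (preim sub_incl_cont V) `<=` V.
Proof. by move=> _ [y Vy <-]. Qed.

Definition sub_sharp (V : opens X) :
  {rmorphism sec V -> @sec sub_scheme (preim sub_incl_cont V)} :=
  res (@sub_incl_sub V).

Lemma sub_sharp_res (V W : opens X) (h : W `<=` V)
  (h' : preim sub_incl_cont W `<=` preim sub_incl_cont V) (s : sec V) :
  sub_sharp W (res h s) = res h' (sub_sharp V s).
Proof.
have f : img (preim sub_incl_cont W) `<=` V.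
  by apply: subset_trans h; exact: sub_incl_sub.
by rewrite /= /sub_res !(res_trans _ _ f).
Qed.

Lemma sub_sharp_local (x : sub_scheme) (V : opens X) (s : sec V) :
  oset V (sub_incl x) -> inv_at x (sub_sharp V s) -> inv_at (sub_incl x) s.
Proof. by move=> _ /sub_inv_at /inv_at_res. Qed.

Lemma sub_sharp_str (h : full sub_scheme `<=` preim sub_incl_cont (full X))
  (c : k) : res h (sub_sharp (full X) (str X c)) = str sub_scheme c.
Proof. by rewrite /= /sub_res (res_trans _ _ sub_full). Qed.

Definition incl : hom sub_scheme X :=
  Hom sub_sharp_res sub_sharp_local sub_sharp_str.

Definition aff_str : {rmorphism k -> sec U} :=
  res (@subsetT _ U : U `<=` full X) \o str X.

Lemma U_img_full : U `<=` img (full sub_rs).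
Proof. by rewrite img_full. Qed.
Lemma img_full_U : img (full sub_rs) `<=` U.
Proof. by rewrite img_full. Qed.

Definition aff_iso : {rmorphism sec U -> sec (full sub_scheme)} :=
  res img_full_U.

Lemma aff_iso_bij : bijective aff_iso.
Proof.
exists (res U_img_full) => s; rewrite /aff_iso.
  by rewrite (res_trans _ _ (fun _ => id)) res_id.
by rewrite (res_trans _ _ (fun _ => id)) res_id.
Qed.

Lemma aff_iso_str c : aff_iso (aff_str c) = str sub_scheme c.
Proof. by rewrite /= (res_trans _ _ sub_full). Qed.

(** A morphism into X whose image lies in U factors through the open subscheme;
    this turns a point of U into a point of an affine scheme, where naturality
    of the represented functor applies. *)
Section Factor.
Variables (Y : scheme k) (u : hom Y X).
Hypothesis uU : forall y, oset U (u y).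

Definition fac (y : Y) : sub_scheme := exist _ (u y) (uU y).

Lemma fac_preim (V : opens sub_scheme) y :
  oset V (fac y) <-> oset (img V) (u y).
Proof. by rewrite -(imgE V (fac y)). Qed.

Lemma fac_cont : continuous fac.
Proof.
apply/continuousP => A oA.
have := oset_open (preim (hcont u) (img (Opens oA))).
congr open; apply/seteqP.
by split=> y /(fac_preim (Opens oA)).
Qed.

Lemma fac_sub (V : opens sub_scheme) :
  preim fac_cont V `<=` preim (hcont u) (img V).
Proof. by move=> y /fac_preim. Qed.

Definition fac_sharp (V : opens sub_scheme) :
  {rmorphism sec V -> sec (preim fac_cont V)} :=
  res (@fac_sub V) \o sharp u (img V).

Lemma fac_sharp_res (V W : opens sub_scheme) (h : W `<=` V)
  (h' : preim fac_cont W `<=` preim fac_cont V) (s : sec V) :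
  fac_sharp W (res h s) = res h' (fac_sharp V s).
Proof.
have g : preim (hcont u) (img W) `<=` preim (hcont u) (img V).
  by move=> y /=; apply: img_sub.
have f : preim fac_cont W `<=` preim (hcont u) (img V).
  by apply: subset_trans g; exact: fac_sub.
by rewrite /= /sub_res (sharp_res _ g) !(res_trans _ _ f).
Qed.

Lemma fac_sharp_local (y : Y) (V : opens sub_scheme) (s : sec V) :
  oset V (fac y) -> inv_at y (fac_sharp V s) -> inv_at (fac y) s.
Proof.
move=> Vy /inv_at_res /sharp_local h; apply/sub_inv_at; apply: h.
exact/fac_preim.
Qed.

Lemma fac_sharp_str (h : full Y `<=` preim fac_cont (full sub_scheme)) (c : k) :
  res h (fac_sharp (full sub_scheme) (str sub_scheme c)) = str Y c.
Proof.
have f : full Y `<=` preim (hcont u) (full X) by [].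
rewrite -(sharp_str f) /=.
have g : preim (hcont u) (img (full sub_rs)) `<=` preim (hcont u) (full X).
  by [].
have e : full Y `<=` preim (hcont u) (img (full sub_rs)).
  by move=> y _; apply: U_img_full; exact: uU.
by rewrite (sharp_res _ g) (res_trans _ _ e) (res_trans _ _ f).
Qed.

Definition factor : hom Y sub_scheme :=
  Hom fac_sharp_res fac_sharp_local fac_sharp_str.

Lemma comp_factor : comp_hom incl factor = u.
Proof.
apply: hom_ext => // V h s /=; rewrite /comp_sharp /=.
have g : preim (hcont u) (img (preim sub_incl_cont V)) `<=`
         preim (hcont u) V.
  by move=> y /=; apply: sub_incl_sub.
rewrite (sharp_res _ g).
have f : preim (hcont (comp_hom incl factor)) V `<=`
         preim (hcont u) (img (preim sub_incl_cont V)).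
  by apply: subset_trans (@fac_sub _).
by rewrite (res_trans _ _ f) (res_trans _ _ h).
Qed.
End Factor.
End OpenSubscheme.

(** * The universal family over an affine open set *)

Lemma inv_at_sharp (k : fieldType) (X Y : scheme k) (u : hom X Y) (x : X)
  (V : opens Y) (s : sec V) : inv_at (u x) s -> inv_at x (sharp u V s).
Proof.
move=> [W [h [t [Wx e]]]].
have h' : preim (hcont u) W `<=` preim (hcont u) V by move=> y; apply: h.
exists (preim (hcont u) W), h', (sharp u W t); split=> //.
by rewrite -(sharp_res h) -rmorphM e rmorph1.
Qed.

Section Chart.
Variables (k : fieldType) (X : scheme k) (U : opens X).
Hypotheses (Uaff : affine_open U) (nz : 1 != 0 :> sec U).
Local Notation A := (algebra_of nz (aff_str U)).

Definition aff_spec : spec_of A (sub_scheme Uaff) :=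
  @spec_of_algebra k (sec U) nz (aff_str U) (sub_scheme Uaff) (aff_iso Uaff)
    (sub_full_affine Uaff) (aff_iso_bij Uaff) (aff_iso_str Uaff).

Section Value.
Variables (K : fieldType) (phi : {rmorphism k -> K}).
Variable (u : hom (pt_scheme phi) X).
Hypothesis uU : oset U (u tt).
Local Notation B := (algebra_of (oner_neq0 K) phi).
Local Notation T := (pt_scheme phi).

Lemma pt_in_preim : full T `<=` preim (hcont u) U. Proof. by case. Qed.

Definition pt_value (a : A) : B :=
  res pt_in_preim (sharp u U a) (exist _ tt I).

Lemma pt_value_nmod : nmod_morphism pt_value.
Proof. by split=> [|a b]; rewrite /pt_value ?raddf0 ?raddfD. Qed.
Lemma pt_value_monoid : monoid_morphism pt_value.
Proof. by split=> [|a b]; rewrite /pt_value ?rmorph1 ?rmorphM. Qed.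
HB.instance Definition _ :=
  GRing.isNmodMorphism.Build A B pt_value pt_value_nmod.
HB.instance Definition _ :=
  GRing.isMonoidMorphism.Build A B pt_value pt_value_monoid.

Lemma pt_value_str c : pt_value (aff_str U c) = phi c.
Proof.
rewrite /pt_value /aff_str.
have f : full T `<=` preim (hcont u) (full X) by [].
have g : preim (hcont u) U `<=` preim (hcont u) (full X) by [].
change (res pt_in_preim
  (sharp u U (res (@subsetT _ U : U `<=` full X) (str X c)))
  (exist _ tt I) = phi c).
by rewrite (sharp_res _ g) (res_trans _ _ f) (sharp_str f).
Qed.

Lemma pt_value_scalable : scalable pt_value.
Proof.
move=> c a; rewrite -[c *: a]mulr_algl rmorphM algebra_ofE /=.
by rewrite pt_value_str -[in RHS]mulr_algl algebra_ofE.
Qed.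
HB.instance Definition _ :=
  GRing.isScalable.Build k A B *:%R pt_value pt_value_scalable.

(** The function [s] is nonzero at a field-valued point iff its germ there is a
    unit: nonvanishing is a condition on the underlying point of X alone. *)
Lemma pt_value_inv (s : sec U) : pt_value s != 0 <-> inv_at (u tt) s.
Proof.
split=> [s0|/inv_at_sharp /= su].
  apply: (@sharp_local _ _ _ u tt _ s uU).
  have: inv_at (tt : T) (res pt_in_preim (sharp u U s)).
    exact/(@pt_inv_atP _ _ (full T) I).
  exact: inv_at_res.
apply/(@pt_inv_atP _ tt (full T) I).
case: su => W [h [t [Wx e]]].
exists W, (fun _ _ => I), t; split=> //.
by rewrite -e; congr (_ * _); apply: res_trans.
Qed.
End Value.
End Chart.

Section UniversalFamily.
Variables (k : fieldType) (X : scheme k) (F : comAlgType k -> Type).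
Variable (pullF : forall A B : comAlgType k,
  {lrmorphism A -> B} -> F A -> F B -> Prop).
Variable Phi : forall (A : comAlgType k) (T : scheme k),
  spec_of A T -> hom T X -> F A.
Hypothesis Phi_nat :
  forall (A B : comAlgType k) T T' (i : spec_of A T) (j : spec_of B T')
    (f : {lrmorphism A -> B}) (g : hom T' T)
    (h : full T' `<=` preim (hcont g) (full T)),
    (forall a : A, res h (sharp g (full T) (i a)) = j (f a)) ->
    forall u : hom T X,
      pullF f (Phi i u) (Phi j (comp_hom u g)).

(** The element that the inclusion of U represents is universal: by naturality
    applied to the factorization through U, it restricts to the element of
    every field-valued point of U, along evaluation of functions. *)
Lemma universal_family (U : opens X) (Uaff : affine_open U)
  (nz : 1 != 0 :> sec U) :
  exists Y : F (algebra_of nz (aff_str U)),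
  forall (K : fieldType) (phi : {rmorphism k -> K})
    (u : hom (pt_scheme phi) X) (uU : oset U (u tt)),
    pullF (@pt_value _ _ _ nz _ _ _ uU) Y (Phi (pt_spec phi) u).
Proof.
exists (Phi (aff_spec Uaff nz) (incl Uaff)) => K phi u uU.
have uU' : forall y, oset U (u y) by case.
rewrite -[X in pullF _ _ X](congr1 (Phi _) (comp_factor Uaff uU')).
have h : full (pt_scheme phi) `<=`
  preim (hcont (factor Uaff uU')) (full (sub_scheme Uaff)) by [].
apply: (Phi_nat (f := @pt_value _ _ _ nz _ _ _ uU) (h := h)) => a.
apply/funext => -[[] []].
change (res h (res (@fac_sub _ _ _ Uaff _ _ uU' (full (sub_scheme Uaff)))
   (sharp u (img (full (sub_scheme Uaff))) (res (@img_full_U _ _ U) a)))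
   (exist _ tt I) = res (pt_in_preim uU) (sharp u U a) (exist _ tt I)).
have g : preim (hcont u) (img (full (sub_scheme Uaff))) `<=`
         preim (hcont u) U by move=> y; exact: (@img_subU X U).
by rewrite (sharp_res _ g) !(res_trans _ _ (pt_in_preim uU)).
Qed.
End UniversalFamily.

(** * The residue field of a point *)

Section InvAt.
Variables (X : ringedSpace) (x : X).

Definition meet (U V : opens X) : opens X :=
  Opens (openI (oset_open U) (oset_open V)).
Lemma meetl (U V : opens X) : meet U V `<=` U. Proof. by move=> y []. Qed.
Lemma meetr (U V : opens X) : meet U V `<=` V. Proof. by move=> y []. Qed.

Lemma inv_at_resE (U V : opens X) (h : V `<=` U) (s : sec U) :
  oset V x -> inv_at x (res h s) <-> inv_at x s.
Proof.
move=> Vx; split=> [/inv_at_res //|[W [g [t [Wx e]]]]].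
have f : meet V W `<=` U by move=> y /meetl /h.
exists (meet V W), (@meetl V W), (res (@meetr V W) t); split=> //.
rewrite (res_trans _ _ f) -(rmorph1 (res (@meetr V W))) -e rmorphM.
by rewrite (res_trans _ _ f).
Qed.

Lemma inv_atM (U : opens X) (s t : sec U) : inv_at x (s * t) -> inv_at x t.
Proof.
move=> [V [h [r [Vx e]]]]; exists V, h, (r * res h s); split=> //.
by rewrite -mulrA -rmorphM.
Qed.
End InvAt.

Section ResidueField.
Variables (X : ringedSpace) (Xlr : locally_ringed X) (x : X).

Lemma inv_atN (U : opens X) (s : sec U) : inv_at x (- s) -> inv_at x s.
Proof. by rewrite -mulN1r => /inv_atM. Qed.

Lemma inv_at1 (U : opens X) : oset U x -> inv_at x (1 : sec U).
Proof.
by move=> Ux; exists U, (fun _ => id), 1; split=> //; rewrite rmorph1 mulr1.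
Qed.

(** The residue field is built in one step: sections over neighbourhoods of x
    are identified when their difference is not invertible at x, which is the
    quotient of the stalk by its maximal ideal. *)
Record germ := Germ { gopen : opens X; gmem : oset gopen x; gsec : sec gopen }.
HB.instance Definition _ := gen_eqMixin germ.
HB.instance Definition _ := gen_choiceMixin germ.

Definition germ_eq (g g' : germ) : Prop :=
  ~ inv_at x (res (@meetl X (gopen g) (gopen g')) (gsec g) -
              res (@meetr X (gopen g) (gopen g')) (gsec g')).

Lemma germ_eqP (g g' : germ) (W : opens X) (h : W `<=` gopen g)
  (h' : W `<=` gopen g') : oset W x ->
  germ_eq g g' <-> ~ inv_at x (res h (gsec g) - res h' (gsec g')).
Proof.
move=> Wx; have f : W `<=` meet (gopen g) (gopen g').
  by move=> y Wy; split; [exact: h|exact: h'].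
rewrite /germ_eq -(inv_at_resE f _ Wx) rmorphB.
by rewrite (res_trans _ _ h) (res_trans _ _ h').
Qed.

Definition germ_rel (g g' : germ) : bool := `[< germ_eq g g' >].

Lemma germ_refl : reflexive germ_rel.
Proof.
move=> g; apply/asboolP/(@germ_eqP g g _ (fun _ => id) (fun _ => id) (gmem g)).
by rewrite subrr; have [] := Xlr (gmem g).
Qed.
Lemma germ_sym : ssrbool.symmetric germ_rel.
Proof.
suff H g g' : germ_eq g g' -> germ_eq g' g.
  by move=> g g'; apply/asboolP/asboolP; exact: H.
have m : oset (meet (gopen g) (gopen g')) x by split; exact: gmem.
move=> /(germ_eqP (@meetl _ _ _) (@meetr _ _ _) m) e.
apply/(germ_eqP (@meetr _ _ _) (@meetl _ _ _) m).
by apply: contra_not e => e; apply: inv_atN; rewrite opprB.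
Qed.
Lemma germ_trans : transitive germ_rel.
Proof.
move=> g2 g1 g3 /asboolP e12 /asboolP e23; apply/asboolP.
pose W := meet (gopen g1) (meet (gopen g2) (gopen g3)).
have h1 : W `<=` gopen g1 by move=> y [].
have h2 : W `<=` gopen g2 by move=> y [? []].
have h3 : W `<=` gopen g3 by move=> y [? []].
have Wx : oset W x by split; [|split]; exact: gmem.
move/(germ_eqP h1 h2 Wx): e12 => e12; move/(germ_eqP h2 h3 Wx): e23 => e23.
apply/(germ_eqP h1 h3 Wx); rewrite -(subrKA (res h2 (gsec g2))) => i.
by have [_ /(_ _ _ i) []] := Xlr Wx.
Qed.

Definition germ_equiv := EquivRel germ_rel germ_refl germ_sym germ_trans.

Definition resfield := {eq_quot germ_equiv}.
HB.instance Definition _ := Choice.on resfield.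

Definition ev (U : opens X) (Ux : oset U x) (s : sec U) : resfield :=
  \pi_resfield (Germ Ux s).

Lemma ev_res (U V : opens X) (h : V `<=` U) (Ux : oset U x) (Vx : oset V x)
  (s : sec U) : ev Vx (res h s) = ev Ux s.
Proof.
apply/eqmodP/asboolP/(@germ_eqP (Germ _ _) (Germ _ _) V (fun _ => id) h Vx).
by rewrite /= res_id subrr; have [] := Xlr Vx.
Qed.

Lemma ev_eqP (U : opens X) (Ux : oset U x) (s t : sec U) :
  ev Ux s = ev Ux t <-> ~ inv_at x (s - t).
Proof.
have H := @germ_eqP (Germ Ux s) (Germ Ux t) U (fun _ => id) (fun _ => id) Ux.
rewrite /= !res_id in H.
by split=> [/eqmodP/asboolP/H|/H] // e; apply/eqmodP/asboolP.
Qed.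

(** Finitely many elements of the residue field are values of sections over one
    common neighbourhood, so that each ring axiom below is inherited from the
    ring of sections there. *)
Lemma ev_surj1 (a : resfield) :
  exists (U : opens X) (Ux : oset U x) (s : sec U), a = ev Ux s.
Proof.
elim/quotW: a => -[U Ux s]; by exists U, Ux, s.
Qed.

Lemma ev_surj2 (a b : resfield) :
  exists (U : opens X) (Ux : oset U x) (s t : sec U),
    a = ev Ux s /\ b = ev Ux t.
Proof.
have [U [Ux [s ->]]] := ev_surj1 a; have [V [Vx [t ->]]] := ev_surj1 b.
have m : oset (meet U V) x by split.
exists (meet U V), m, (res (@meetl _ U V) s), (res (@meetr _ U V) t).
by rewrite !ev_res.
Qed.

Lemma ev_surj3 (a b c : resfield) :
  exists (U : opens X) (Ux : oset U x) (s t r : sec U),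
    [/\ a = ev Ux s, b = ev Ux t & c = ev Ux r].
Proof.
have [U [Ux [s [t [-> ->]]]]] := ev_surj2 a b.
have [V [Vx [r ->]]] := ev_surj1 c.
have m : oset (meet U V) x by split.
exists (meet U V), m, (res (@meetl _ U V) s), (res (@meetl _ U V) t),
  (res (@meetr _ U V) r).
by rewrite !ev_res.
Qed.

Definition germ_op (op : forall U : opens X, sec U -> sec U -> sec U)
  (a b : resfield) : resfield :=
  let g := repr a in let g' := repr b in
  ev (conj (gmem g) (gmem g') : oset (meet (gopen g) (gopen g')) x)
    (op _ (res (@meetl _ _ _) (gsec g)) (res (@meetr _ _ _) (gsec g'))).

Lemma germ_opE (op : forall U : opens X, sec U -> sec U -> sec U) :
  (forall (U V : opens X) (h : V `<=` U) (s t : sec U),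
     res h (op U s t) = op V (res h s) (res h t)) ->
  (forall (U : opens X) (Ux : oset U x) (s t s' t' : sec U),
     ~ inv_at x (s - s') -> ~ inv_at x (t - t') ->
     ~ inv_at x (op U s t - op U s' t')) ->
  forall (U : opens X) (Ux : oset U x) (s t : sec U),
  germ_op op (ev Ux s) (ev Ux t) = ev Ux (op U s t).
Proof.
move=> opr opc U Ux s t; rewrite /germ_op.
set g := repr (ev Ux s); set g' := repr (ev Ux t).
have eg : ev (gmem g) (gsec g) = ev Ux s.
  by rewrite -[RHS]reprK /ev -/g; case: g.
have eg' : ev (gmem g') (gsec g') = ev Ux t.
  by rewrite -[RHS]reprK /ev -/g'; case: g'.
pose W := meet U (meet (gopen g) (gopen g')).
have Wx : oset W x by split=> //; split; exact: gmem.
have h : W `<=` meet (gopen g) (gopen g') by move=> y [].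
have hU : W `<=` U by move=> y [].
have h1 : W `<=` gopen g by move=> y [_ []].
have h2 : W `<=` gopen g' by move=> y [_ []].
rewrite -(ev_res h _ Wx) -(ev_res hU _ Wx) !opr.
rewrite (res_trans _ _ h1) (res_trans _ _ h2).
apply/(ev_eqP Wx); apply: opc => //; apply/(ev_eqP Wx).
  by rewrite (ev_res _ (gmem g)) eg ev_res.
by rewrite (ev_res _ (gmem g')) eg' ev_res.
Qed.

Definition rf_zero : resfield := @ev (full X) I 0.
Definition rf_one : resfield := @ev (full X) I 1.
Definition rf_add := germ_op (fun U s t => s + t).
Definition rf_mul := germ_op (fun U s t => s * t).

Lemma van_add (U : opens X) (Ux : oset U x) (s t : sec U) :
  ~ inv_at x s -> ~ inv_at x t -> ~ inv_at x (s + t).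
Proof. by move=> ns nt i; have [_ /(_ _ _ i) []] := Xlr Ux. Qed.

Lemma rf_addE (U : opens X) (Ux : oset U x) (s t : sec U) :
  rf_add (ev Ux s) (ev Ux t) = ev Ux (s + t).
Proof.
apply: germ_opE => [V W h a b|V Vx a b a' b' na nb]; first exact: rmorphD.
by rewrite opprD addrACA; apply: van_add.
Qed.

Lemma rf_mulE (U : opens X) (Ux : oset U x) (s t : sec U) :
  rf_mul (ev Ux s) (ev Ux t) = ev Ux (s * t).
Proof.
apply: germ_opE => [V W h a b|V Vx a b a' b' na nb]; first exact: rmorphM.
rewrite (_ : _ - _ = b * (a - a') + a' * (b - b')).
  by apply: van_add => //; move=> /inv_atM.
by rewrite !mulrBr addrA (mulrC b a') subrK mulrC.
Qed.

Lemma rf_zeroE (U : opens X) (Ux : oset U x) : rf_zero = ev Ux 0.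
Proof.
have h : U `<=` full X by [].
by rewrite /rf_zero -(ev_res h _ Ux) rmorph0.
Qed.
Lemma rf_oneE (U : opens X) (Ux : oset U x) : rf_one = ev Ux 1.
Proof.
have h : U `<=` full X by [].
by rewrite /rf_one -(ev_res h _ Ux) rmorph1.
Qed.

Definition rf_opp := rf_mul (@ev (full X) I (-1)).
Lemma rf_oppE (U : opens X) (Ux : oset U x) (s : sec U) :
  rf_opp (ev Ux s) = ev Ux (- s).
Proof.
have h : U `<=` full X by [].
by rewrite /rf_opp -(ev_res h _ Ux) rf_mulE rmorphN1 mulN1r.
Qed.

Lemma rf_addA : associative rf_add.
Proof.
move=> a b c; have [U [Ux [s [t [r [-> -> ->]]]]]] := ev_surj3 a b c.
by rewrite !rf_addE addrA.
Qed.
Lemma rf_addC : commutative rf_add.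
Proof.
move=> a b; have [U [Ux [s [t [-> ->]]]]] := ev_surj2 a b.
by rewrite !rf_addE addrC.
Qed.
Lemma rf_add0 : left_id rf_zero rf_add.
Proof.
move=> a; have [U [Ux [s ->]]] := ev_surj1 a.
by rewrite (rf_zeroE Ux) rf_addE add0r.
Qed.
Lemma rf_addN : left_inverse rf_zero rf_opp rf_add.
Proof.
move=> a; have [U [Ux [s ->]]] := ev_surj1 a.
by rewrite rf_oppE rf_addE addNr (rf_zeroE Ux).
Qed.
Lemma rf_mulA : associative rf_mul.
Proof.
move=> a b c; have [U [Ux [s [t [r [-> -> ->]]]]]] := ev_surj3 a b c.
by rewrite !rf_mulE mulrA.
Qed.
Lemma rf_mulC : commutative rf_mul.
Proof.
move=> a b; have [U [Ux [s [t [-> ->]]]]] := ev_surj2 a b.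
by rewrite !rf_mulE mulrC.
Qed.
Lemma rf_mul1 : left_id rf_one rf_mul.
Proof.
move=> a; have [U [Ux [s ->]]] := ev_surj1 a.
by rewrite (rf_oneE Ux) rf_mulE mul1r.
Qed.
Lemma rf_mulD : left_distributive rf_mul rf_add.
Proof.
move=> a b c; have [U [Ux [s [t [r [-> -> ->]]]]]] := ev_surj3 a b c.
by rewrite !(rf_mulE, rf_addE) mulrDl.
Qed.
Lemma rf_neq0 : rf_one != rf_zero.
Proof. by apply/eqP => /ev_eqP; rewrite subr0; apply; exact: inv_at1. Qed.

HB.instance Definition _ := GRing.isZmodule.Build resfield
  rf_addA rf_addC rf_add0 rf_addN.
HB.instance Definition _ := GRing.Zmodule_isComNzRing.Build resfield
  rf_mulA rf_mulC rf_mul1 rf_mulD rf_neq0.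

Lemma ev_neq0 (U : opens X) (Ux : oset U x) (s : sec U) :
  ev Ux s != 0 <-> inv_at x s.
Proof.
rewrite [0 in X in X <-> _](rf_zeroE Ux) -[s in inv_at _ s]subr0.
split=> [e|e]; last by apply/eqP => /ev_eqP.
by apply: contrapT => /(ev_eqP Ux) e'; rewrite e' eqxx in e.
Qed.

Lemma rf_has_inv (a : resfield) : a != 0 -> exists b : resfield, b * a = 1.
Proof.
have [U [Ux [s ->]]] := ev_surj1 a => /ev_neq0 [V [h [t [Vx e]]]].
exists (ev Vx t); rewrite -(ev_res h _ Vx) [LHS]rf_mulE e.
by rewrite -(rf_oneE Vx).
Qed.

Definition rf_inv (a : resfield) : resfield :=
  if pselect (exists b : resfield, b * a = 1) is left e
  then projT1 (cid e) else 0.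
Lemma rf_mulV (a : resfield) : a != 0 -> rf_inv a * a = 1.
Proof.
rewrite /rf_inv => /rf_has_inv; case: pselect => // e _.
exact: projT2 (cid e).
Qed.
Lemma rf_inv0 : rf_inv 0 = 0.
Proof.
rewrite /rf_inv; case: pselect => // -[b e]; exfalso.
by move/eqP: e; rewrite mulr0 eq_sym oner_eq0.
Qed.
HB.instance Definition _ := GRing.ComNzRing_isField.Build resfield
  rf_mulV rf_inv0.

Lemma ev_nmod (U : opens X) (Ux : oset U x) : nmod_morphism (ev Ux).
Proof. by split=> [|s t]; [rewrite -rf_zeroE|rewrite -rf_addE]. Qed.
Lemma ev_monoid (U : opens X) (Ux : oset U x) : monoid_morphism (ev Ux).
Proof. by split=> [|s t]; [rewrite -rf_oneE|rewrite -rf_mulE]. Qed.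
HB.instance Definition _ (U : opens X) (Ux : oset U x) :=
  GRing.isNmodMorphism.Build (sec U) resfield (ev Ux) (ev_nmod Ux).
HB.instance Definition _ (U : opens X) (Ux : oset U x) :=
  GRing.isMonoidMorphism.Build (sec U) resfield (ev Ux) (ev_monoid Ux).
End ResidueField.

Section ResiduePoint.
Variables (k : fieldType) (X : scheme k) (x : X).
Local Notation K := (resfield (@scheme_lr k X) x).
Local Notation ev := (ev (@scheme_lr k X)).

Definition rp_str : {rmorphism k -> K} := ev (I : oset (full X) x) \o str X.
Local Notation T := (pt_scheme rp_str).

Definition rp_fun (y : T) : X := x.
Lemma rp_cont : continuous rp_fun.
Proof. exact: cst_continuous. Qed.

Definition rp_sharp_fun (V : opens X) (s : sec V) : sec (preim rp_cont V) :=
  fun y => ev (svalP y) s.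
Lemma rp_sharp_nmod (V : opens X) : nmod_morphism (@rp_sharp_fun V).
Proof.
by split=> [|s t]; apply/funext => y; rewrite /rp_sharp_fun ?rmorph0 ?rmorphD.
Qed.
Lemma rp_sharp_monoid (V : opens X) : monoid_morphism (@rp_sharp_fun V).
Proof.
by split=> [|s t]; apply/funext => y; rewrite /rp_sharp_fun ?rmorph1 ?rmorphM.
Qed.
HB.instance Definition _ (V : opens X) :=
  GRing.isNmodMorphism.Build (sec V) (sec (preim rp_cont V))
    (@rp_sharp_fun V) (rp_sharp_nmod V).
HB.instance Definition _ (V : opens X) :=
  GRing.isMonoidMorphism.Build (sec V) (sec (preim rp_cont V))
    (@rp_sharp_fun V) (rp_sharp_monoid V).
Definition rp_sharp (V : opens X) :
  {rmorphism sec V -> sec (preim rp_cont V)} :=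
  @rp_sharp_fun V.

Lemma rp_sharp_res (V W : opens X) (h : W `<=` V)
    (h' : preim rp_cont W `<=` preim rp_cont V) (s : sec V) :
    rp_sharp W (res h s) = res h' (rp_sharp V s).
Proof. by apply/funext => y; exact: ev_res. Qed.

Lemma rp_sharp_local (y : T) (V : opens X) (s : sec V) :
  oset V (rp_fun y) -> inv_at y (rp_sharp V s) -> inv_at (rp_fun y) s.
Proof.
move=> Vx /(@pt_inv_atP _ _ (preim rp_cont V) Vx).
exact: (proj1 (ev_neq0 (@scheme_lr k X) (svalP (exist _ y Vx)) s)).
Qed.

Lemma rp_sharp_str (h : full T `<=` preim rp_cont (full X)) (c : k) :
  res h (rp_sharp (full X) (str X c)) = str T c.
Proof.
by apply/funext => y; congr (ev _ _); exact: Prop_irrelevance.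
Qed.

Definition residue_point : hom T X :=
  Hom rp_sharp_res rp_sharp_local rp_sharp_str.
End ResiduePoint.

Lemma ex_residue_point (k : fieldType) (X : scheme k) (x : X) :
  exists (K : fieldType) (phi : {rmorphism k -> K}) (u : hom (pt_scheme phi) X),
    u tt = x.
Proof. by exists _, _, (residue_point x). Qed.

(** * Bases over a field *)

(** A property rather than a structure, because the fields at hand are
    k-algebras whose ring structure is already fixed. *)
Definition is_field (B : comNzRingType) : Prop :=
  forall b : B, b != 0 -> exists c, c * b = 1.

Section FieldRing.
Variables (B : comNzRingType) (Bf : is_field B).

Lemma is_field_mul_eq0 (a b : B) : a * b = 0 -> a = 0 \/ b = 0.
Proof.
have [->|/Bf[c ca]] := eqVneq a 0; first by left.
by move=> ab; right; rewrite -[b]mul1r -ca -mulrA ab mulr0.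
Qed.

Lemma is_field_mul_neq0 (a b : B) : a != 0 -> b != 0 -> a * b != 0.
Proof.
move=> a0 b0; apply/eqP => /is_field_mul_eq0 []; exact/eqP.
Qed.

Lemma is_field_exp_neq0 (a : B) n : a != 0 -> a ^+ n != 0.
Proof.
move=> a0; elim: n => [|m IH]; first exact: oner_neq0.
by rewrite exprS is_field_mul_neq0.
Qed.

Lemma prime_ker (A : comNzRingType) (f : {rmorphism A -> B}) :
  prime_ideal [set a | f a = 0].
Proof.
split=> /= [|a b a0 b0|a b b0||a b].
- exact: rmorph0.
- by rewrite rmorphD a0 b0 addr0.
- by rewrite rmorphM b0 mulr0.
- by rewrite rmorph1; apply/eqP; exact: oner_neq0.
- by rewrite rmorphM => /is_field_mul_eq0.
Qed.
End FieldRing.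

Section Basis.
Variables (A : comNzRingType) (n d : nat).
Implicit Types M : lmodType {mpoly A[n]}.

Definition generates M (e : 'I_d -> M) :=
  forall m, exists c : 'I_d -> A, m = \sum_i (c i)%:MP *: e i.
Definition independent M (e : 'I_d -> M) :=
  forall c : 'I_d -> A, \sum_i (c i)%:MP *: e i = 0 -> forall i, c i = 0.

Lemma locally_free_basis (Af : is_field A) M :
  locally_free d M -> exists e : 'I_d -> M, generates e /\ independent e.
Proof.
have id_morph : prime_ideal [set a : A | a = 0] := prime_ker Af idfun.
move=> /(_ _ id_morph) [a [e [/= /eqP a0 gen ind]]].
exists e; split=> [m|c /ind [N aN] i].
  have [N [c mE]] := gen m.
  have [b ba] := Af _ (is_field_exp_neq0 Af N a0).
  exists (fun i => b * c i); rewrite -[m]scale1r -(rmorph1 (@mpolyC n _)) -ba.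
  rewrite rmorphM -scalerA mE scaler_sumr.
  by apply: eq_bigr => i _; rewrite scalerA -rmorphM.
have [aN0|//] := is_field_mul_eq0 Af (aN i).
by move: (is_field_exp_neq0 Af N a0); rewrite aN0 eqxx.
Qed.

(** The matrices expressing two generating families in each other are inverse to
    each other on one side, hence on both when they are square. *)
Lemma generates_independent M (e e' : 'I_d -> M) :
  generates e -> independent e -> generates e' -> independent e'.
Proof.
move=> ge ie ge' c ce'0 i.
have [C eC] := choice (fun i => ge (e' i)).
have [D eD] := choice (fun i => ge' (e i)).
pose mC := \matrix_(i, j) C i j; pose mD := \matrix_(i, j) D i j.
have DC : mD *m mC = 1%:M.
  apply/matrixP => a b; rewrite !mxE; apply/eqP; rewrite -subr_eq0; apply/eqP.
  move: b; apply: (ie (fun b => \sum_j mD a j * mC j b - (a == b)%:R)).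
  under eq_bigr do rewrite rmorphB scalerBl.
  rewrite sumrB.
  rewrite (bigD1 (P := predT) (F := fun b => (a == b)%:R%:MP *: e b) a) //=.
  rewrite eqxx rmorph1 scale1r [X in _ - (_ + X)]big1 ?addr0; last first.
    by move=> b /negPf nb; rewrite eq_sym nb rmorph0 scale0r.
  rewrite (eD a); apply/eqP; rewrite subr_eq0; apply/eqP.
  under eq_bigr do rewrite rmorph_sum scaler_suml.
  rewrite exchange_big; apply: eq_bigr => j _; rewrite (eC j) scaler_sumr.
  by apply: eq_bigr => b _; rewrite !mxE rmorphM scalerA.
have cC0 : (\row_j c j) *m mC = 0.
  apply/rowP => b; rewrite !mxE; move: b.
  apply: (ie (fun b => \sum_j (\row_j c j) 0 j * mC j b)).
  under eq_bigr do rewrite rmorph_sum scaler_suml.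
  rewrite exchange_big -[RHS]ce'0; apply: eq_bigr => j _.
  rewrite (eC j) scaler_sumr.
  by apply: eq_bigr => b _; rewrite !mxE rmorphM scalerA.
have : (\row_j c j) 0 i = 0.
  by rewrite -[\row_j c j]mulmx1 -(mulmx1C DC) mulmxA cC0 mul0mx mxE.
by rewrite mxE.
Qed.
End Basis.

(** * Spreading out from a point *)

(** A map [g] from a module over A to a module over B, semilinear along f: the
    map from a family to its restriction. *)
Section Reduction.
Variables (A B : comNzRingType) (n : nat) (f : {rmorphism A -> B}).
Local Notation F := (map_mpoly f : {rmorphism {mpoly A[n]} -> {mpoly B[n]}}).
Variables (M : lmodType {mpoly A[n]}) (M' : lmodType {mpoly B[n]}).
Variable g : {linear M -> M' | F \; *:%R}.

Lemma reduceZ (s : {mpoly A[n]}) m : g (s *: m) = F s *: g m.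
Proof. by rewrite linearZ_LR. Qed.
Lemma reduceC (c : A) m : g (c%:MP *: m) = (f c)%:MP *: g m.
Proof. by rewrite reduceZ /= map_mpolyC. Qed.

Lemma reduce_comb d (c : 'I_d -> A) (e : 'I_d -> M) :
  g (\sum_i (c i)%:MP *: e i) = \sum_i (f (c i))%:MP *: g (e i).
Proof. by rewrite raddf_sum; apply: eq_bigr => i _; exact: reduceC. Qed.

(** A polynomial over B is a B-combination of monomials, and monomials come from
    A; so the B-span of the image of [g] is stable under all polynomials. *)
Lemma reduce_span (Q : M' -> Prop) :
  Q 0 -> (forall a b, Q a -> Q b -> Q (a + b)) ->
  (forall (c : B) a, Q a -> Q (c%:MP *: a)) ->
  (forall m, Q (g m)) -> forall (s : {mpoly B[n]}) m, Q (s *: g m).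
Proof.
move=> Q0 QD QZ Qg s m; rewrite [s]mpolyE scaler_suml.
elim/big_ind: _ => // t _.
by rewrite -mul_mpolyC -scalerA -(map_mpolyX f) -reduceZ; apply: QZ.
Qed.
End Reduction.

Section Spreading.
Variables (A B : comNzRingType) (Bf : is_field B) (n d : nat).
Variable (f : {rmorphism A -> B}).
Local Notation F := (map_mpoly f : {rmorphism {mpoly A[n]} -> {mpoly B[n]}}).
Variables (M : lmodType {mpoly A[n]}) (M' : lmodType {mpoly B[n]}).
Variable g : {linear M -> M' | F \; *:%R}.

(** The image of [h] generates L' as a module over B', not merely over the
    polynomial ring; stated as an induction principle. *)
Definition spans (A' B' : comNzRingType) (f' : {rmorphism A' -> B'})
  (L : lmodType {mpoly A'[n]}) (L' : lmodType {mpoly B'[n]}) (h : L -> L') :=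
  forall Q : L' -> Prop,
  Q 0 -> (forall a b, Q a -> Q b -> Q (a + b)) ->
  (forall (c : B') a, Q a -> Q (c%:MP *: a)) ->
  (forall m, Q (h m)) -> forall m', Q m'.

Lemma local_comb_fibre (a : A) N m (e : 'I_d -> M) (c : 'I_d -> A) :
  (a ^+ N)%:MP *: m = \sum_i (c i)%:MP *: e i ->
  (f a ^+ N)%:MP *: g m = \sum_i (f (c i))%:MP *: g (e i).
Proof. by move=> mE; rewrite -rmorphXn -reduceC mE reduce_comb. Qed.

Lemma local_gen_fibre (a : A) (e : 'I_d -> M) :
  f a != 0 ->
  (forall m : M, exists (N : nat) (c : 'I_d -> A),
      (a ^+ N)%:MP *: m = \sum_(i < d) (c i)%:MP *: e i) ->
  spans f g -> generates (fun i => g (e i)).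
Proof.
move=> fa gen; apply=> [|x y [c ->] [c' ->]|b x [c ->]|m].
- exists (fun=> 0); rewrite big1 // => i _.
  by rewrite rmorph0 scale0r.
- exists (fun i => c i + c' i); rewrite -big_split; apply: eq_bigr => i _.
  by rewrite rmorphD scalerDl.
- exists (fun i => b * c i); rewrite scaler_sumr; apply: eq_bigr => i _.
  by rewrite rmorphM scalerA.
have [N [c mE]] := gen m.
have [b ba] := Bf (is_field_exp_neq0 Bf N fa).
exists (fun i => b * f (c i)).
rewrite -[g m]scale1r -(rmorph1 (@mpolyC n _)) -ba rmorphM -scalerA.
rewrite (local_comb_fibre mE) scaler_sumr.
by apply: eq_bigr => i _; rewrite rmorphM scalerA.
Qed.
End Spreading.

Section Open.
Variables (A B : comNzRingType) (Bf : is_field B) (n d : nat).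
Variable (f : {rmorphism A -> B}).
Local Notation F := (map_mpoly f : {rmorphism {mpoly A[n]} -> {mpoly B[n]}}).
Variables (M : lmodType {mpoly A[n]}) (M' : lmodType {mpoly B[n]}).
Variable g : {linear M -> M' | F \; *:%R}.
Hypotheses (Mfree : locally_free d M) (M'free : locally_free d M').

(** Local generators of M give d generators of the fibre M', which form a basis
    because M' has dimension d. *)
Lemma local_basis : exists (a : A) (e : 'I_d -> M), [/\ f a != 0,
    forall m : M, exists (N : nat) (c : 'I_d -> A),
      (a ^+ N)%:MP *: m = \sum_(i < d) (c i)%:MP *: e i &
    spans f g -> generates (fun i => g (e i)) /\
      independent (fun i => g (e i))].
Proof.
have [a [e [/= /eqP fa gen _]]] := Mfree (prime_ker Bf f).
exists a, e; split=> // sp.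
have [b [gb ib]] := locally_free_basis Bf M'free.
have ge := local_gen_fibre Bf fa gen sp.
by split=> //; exact: generates_independent gb ib ge.
Qed.

(** Nakayama's lemma in determinant form: if a submodule N fills the fibre at a
    point, it fills M over a neighbourhood D(h) of the point. *)
Lemma spread_submodule (N : M -> Prop) :
  N 0 -> (forall a b, N a -> N b -> N (a + b)) ->
  (forall (c : A) a, N a -> N (c%:MP *: a)) ->
  (forall m', exists m, N m /\ g m = m') ->
  exists h : A, f h != 0 /\ forall m, exists j, N ((h ^+ j)%:MP *: m).
Proof.
move=> N0 ND NZ sur.
have [a [e [fa gen /(_ _)[]]]] := local_basis.
  by move=> Q _ _ _ Qg m'; have [m [_ <-]] := sur m'.
move=> ge ie.
have [u uP] := choice (fun i => sur (g (e i))).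
have [J JP] := choice (fun i => gen (e i - u i)).
have [C CP] := choice JP.
(* Independence in the fibre: the C i j vanish at the point. *)
have fC i j : f (C i j) = 0.
  move: j; apply: ie; rewrite -(reduce_comb g (C i) e) -CP reduceC.
  by rewrite linearB /= (proj2 (uP i)) subrr scaler0.
have Nsum (I : finType) (v : I -> M) : (forall i, N (v i)) -> N (\sum_i v i).
  by move=> Nv; elim/big_ind: _.
(* The matrix D is invertible at the point and maps the e j into N; Cramer's
   rule then puts (\det D) e l into N. *)
pose D := \matrix_(i, j) ((i == j)%:R * a ^+ J i - C i j).
have De i : N (\sum_j (D i j)%:MP *: e j).
  have -> : \sum_j (D i j)%:MP *: e j = (a ^+ J i)%:MP *: u i.
    under eq_bigr do rewrite mxE rmorphB scalerBl.
    rewrite sumrB -CP (bigD1 i) //= eqxx mul1r big1 ?addr0.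
      by rewrite -scalerBr opprB addrCA subrr addr0.
    by move=> j /negPf nj; rewrite eq_sym nj mul0r rmorph0 scale0r.
  by apply: NZ; exact: (proj1 (uP i)).
have dete l : N ((\det D)%:MP *: e l).
  have -> : (\det D)%:MP *: e l =
      \sum_i (\adj D l i)%:MP *: \sum_j (D i j)%:MP *: e j.
    under eq_bigr do rewrite scaler_sumr.
    rewrite exchange_big /=; under eq_bigr => j _.
      under eq_bigr do rewrite scalerA -rmorphM.
      rewrite -scaler_suml -rmorph_sum.
      have -> : \sum_i \adj D l i * D i j = (\adj D *m D) l j.
        by rewrite mxE.
      rewrite mul_adj_mx mxE.
      over.
    rewrite (bigD1 l) //= eqxx mulr1n big1 ?addr0 // => j /negPf nj.
    by rewrite eq_sym nj mulr0n rmorph0 scale0r.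
  by apply: Nsum => i; exact: NZ.
exists (a * \det D); split.
  rewrite rmorphM is_field_mul_neq0 // -det_map_mx.
  have -> : map_mx f D = diag_mx (\row_i f a ^+ J i).
    apply/matrixP => i j; rewrite !mxE rmorphB fC subr0 rmorphM rmorphXn.
    by rewrite rmorph_nat mulr_natl.
  rewrite det_diag; elim/big_ind: _ => [|x y|i _].
  - exact: oner_neq0.
  - exact: is_field_mul_neq0.
  - by rewrite mxE is_field_exp_neq0.
(* The exponent exceeds j by one because the e i enter N only after another
   multiplication by \det D. *)
move=> m; have [j [c mE]] := gen m; exists j.+1.
have -> : ((a * \det D) ^+ j.+1)%:MP *: m =
    \sum_i (a * \det D ^+ j * c i)%:MP *: ((\det D)%:MP *: e i).
  have -> : (a * \det D) ^+ j.+1 = a * \det D ^+ j.+1 * a ^+ j.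
    by rewrite exprMn !exprS; ring.
  rewrite rmorphM -scalerA mE scaler_sumr; apply: eq_bigr => i _.
  by rewrite !scalerA -!rmorphM exprS; congr (_%:MP *: _); ring.
by apply: Nsum => i; apply: NZ.
Qed.

(** If z is nonzero at a point, so is one of its coordinates in a local basis;
    where that coordinate stays nonzero, so does z. *)
Lemma spread_nonzero (z : M) : g z != 0 ->
  exists h : A, f h != 0 /\
  forall (B' : comNzRingType) (B'f : is_field B') (f' : {rmorphism A -> B'})
    (L : lmodType {mpoly B'[n]})
    (g' : {linear M -> L |
      (map_mpoly f' : {rmorphism {mpoly A[n]} -> {mpoly B'[n]}}) \; *:%R}),
  locally_free d L -> spans f' g' -> f' h != 0 -> g' z != 0.
Proof.
move=> gz; have [a [e [/= /eqP fa gen _]]] := Mfree (prime_ker Bf f).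
have [N [c zE]] := gen z.
have [i fci] : exists i, f (c i) != 0.
  apply: contrapT => nc; move/eqP: gz; apply.
  have [b ba] := Bf (is_field_exp_neq0 Bf N fa).
  rewrite -[g z]scale1r -(rmorph1 (@mpolyC n _)) -ba rmorphM -scalerA.
  rewrite (local_comb_fibre g zE) big1 ?scaler0 // => i _.
  have -> : f (c i) = 0.
    by apply/eqP/negPn/negP => ci; apply: nc; exists i.
  by rewrite rmorph0 scale0r.
exists (a * c i); split; first by rewrite rmorphM is_field_mul_neq0.
move=> B' B'f f' L g' Lfree sp'.
rewrite rmorphM => fac.
have fa' : f' a != 0 by apply: contraNneq fac => ->; rewrite mul0r.
have fc' : f' (c i) != 0 by apply: contraNneq fac => ->; rewrite mulr0.
have [b [gb ib]] := locally_free_basis B'f Lfree.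
have ge := local_gen_fibre B'f fa' gen sp'.
have ie := generates_independent gb ib ge.
apply: contraNneq fc' => g'z; apply/eqP.
apply: (ie (fun i => f' (c i))).
by rewrite -(local_comb_fibre g' zE) g'z scaler0.
Qed.
End Open.

Lemma generates_comp (B : comNzRingType) n d (M L : lmodType {mpoly B[n]})
  (h : {linear M -> L}) (e : 'I_d -> M) :
  (forall x, exists m, h m = x) -> generates e -> generates (fun i => h (e i)).
Proof.
move=> sur ge x; have [m <-] := sur x; have [c ->] := ge m; exists c.
by rewrite linear_sum; apply: eq_bigr => i _; rewrite linearZ.
Qed.

(** The image of a basis is a generating family of the right size, hence again
    a basis. *)
Lemma surjective_injective (B : comNzRingType) (Bf : is_field B) n d
  (M L : lmodType {mpoly B[n]}) (h : {linear M -> L}) :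
  locally_free d M -> locally_free d L -> (forall x, exists m, h m = x) ->
  forall m, h m = 0 -> m = 0.
Proof.
move=> Mf Lf sur m.
have [e [ge _]] := locally_free_basis Bf Mf.
have [e' [ge' ie']] := locally_free_basis Bf Lf.
have ih := generates_independent ge' ie' (generates_comp sur ge).
have [c ->] := ge m; rewrite linear_sum => /= hm.
rewrite big1 // => i _; rewrite [c i](ih c) ?rmorph0 ?scale0r //.
by rewrite -[RHS]hm; apply: eq_bigr => j _; rewrite linearZ.
Qed.

(** * Two incompatible conditions on a triple *)

Section Tensor.
Variables (n d r1 r2 : nat) (A : comNzRingType) (y : bilin n d r1 r2 A).
Local Notation S := {mpoly A[n]}.

Definition tensor (u : 'rV[S]_r1) (v : 'rV[S]_r2) : M3 y :=
  p3 y (p1 y u) (p2 y v).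

Lemma tensorDl u u' v : tensor (u + u') v = tensor u v + tensor u' v.
Proof. by rewrite /tensor raddfD linearDl. Qed.
Lemma tensorDr u v v' : tensor u (v + v') = tensor u v + tensor u v'.
Proof. by rewrite /tensor !raddfD. Qed.
Lemma tensorZl s u v : tensor (s *: u) v = s *: tensor u v.
Proof. by rewrite /tensor linearZ linearZl_LR. Qed.
Lemma tensorZr s u v : tensor u (s *: v) = s *: tensor u v.
Proof. by rewrite /tensor linearZ linearZr_LR. Qed.
Lemma tensor0r u : tensor u 0 = 0.
Proof. by rewrite /tensor !raddf0. Qed.
Lemma tensor0l v : tensor 0 v = 0.
Proof. by rewrite /tensor raddf0 linear0l. Qed.
Lemma tensorNl u v : tensor (- u) v = - tensor u v.
Proof. by rewrite /tensor raddfN linearNl. Qed.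

Lemma tensor_ind (Q : M3 y -> Prop) :
  Q 0 -> (forall a b, Q a -> Q b -> Q (a + b)) ->
  (forall u v, Q (tensor u v)) -> forall m, Q m.
Proof.
move=> Q0 QD QT m; have [N [u [v <-]]] := p3_surj m.
elim/big_ind: _ => // i _.
have [u' <-] := p1_surj (u i); have [v' <-] := p2_surj (v i).
exact: QT.
Qed.

Lemma tensor_basis_ind (Q : M3 y -> Prop) :
  Q 0 -> (forall a b, Q a -> Q b -> Q (a + b)) ->
  (forall i j (s : S), Q (s *: tensor (delta_mx 0 i) (delta_mx 0 j))) ->
  forall m, Q m.
Proof.
move=> Q0 QD QT; apply: tensor_ind => // u v.
rewrite (row_sum_delta u) (row_sum_delta v).
elim/big_ind: (\sum_i u 0 i *: _) => [|a b|i _]; rewrite ?tensor0l ?tensorDl //.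
  exact: QD.
elim/big_ind: _ => [|a b|j _]; rewrite ?tensor0r ?tensorDr //; first exact: QD.
by rewrite tensorZl tensorZr scalerA.
Qed.

Variables i0 i1 i2 : 'I_r1.
Local Notation e i := (delta_mx 0 i : 'rV[S]_r1).

Definition cyclic := forall u, exists s : S, p1 y u = s *: p1 y (e i0).

Definition slice_onto := forall u v, exists w, tensor u v = tensor (e i0) w.

(** When the slice T(e0, -) is bijective and X_i = T(e0, -)^-1 T(e_i, -), this
    says that X_2 X_1 and X_1 X_2 differ at [f]; the form below avoids inverses
    and bases. *)
Definition noncommuting := exists f w w',
  [/\ tensor (e i1) f = tensor (e i0) w, tensor (e i2) f = tensor (e i0) w' &
      tensor (e i2) w <> tensor (e i1) w'].

Definition slice : {linear M2 y -> M3 y} := p3 y (p1 y (e i0)).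

Lemma slice_surj : slice_onto -> forall x, exists m, slice m = x.
Proof.
move=> so; apply: tensor_ind => [|a b [m <-] [m' <-]|u v].
- by exists 0; rewrite raddf0.
- by exists (m + m'); rewrite raddfD.
- by have [w ->] := so u v; exists (p2 y w).
Qed.

Lemma slice_inj : is_field A -> slice_onto -> injective slice.
Proof.
move=> Af so m m' e; apply/eqP; rewrite -subr_eq0; apply/eqP.
apply: (surjective_injective Af (M2_free y) (M3_free y) (slice_surj so)).
by rewrite linearB /= e subrr.
Qed.

Definition noncomm_onto := slice_onto /\ noncommuting.

(** If M1 = S a, then T(s a, v) = T(a, s v): up to the bijection T(a, -), all
    slices are multiplications by elements of S on M2, and these commute. *)
Lemma cyclic_not_noncommuting :
  is_field A -> cyclic -> slice_onto -> ~ noncommuting.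
Proof.
move=> Af cyc so [f [w [w' [ew ew' ne]]]]; apply: ne.
have [s es] := cyc (e i1); have [t et] := cyc (e i2).
have T1 v : tensor (e i1) v = slice (s *: p2 y v).
  by rewrite /tensor es linearZl_LR linearZ.
have T2 v : tensor (e i2) v = slice (t *: p2 y v).
  by rewrite /tensor et linearZl_LR linearZ.
rewrite T1 T2; congr (slice _).
have /(slice_inj Af so) <- : slice (s *: p2 y f) = slice (p2 y w).
  by rewrite -T1.
have /(slice_inj Af so) <- : slice (t *: p2 y f) = slice (p2 y w').
  by rewrite -T2.
by rewrite !scalerA mulrC.
Qed.
End Tensor.

Section KernelInvariance.
Variables (n d r1 r2 : nat) (A : comNzRingType) (x y : bilin n d r1 r2 A).
Hypothesis xy : bilin_eq x y.

Lemma bilin_eq_tensor u v u' v' :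
  tensor x u v = tensor x u' v' <-> tensor y u v = tensor y u' v'.
Proof.
have [_ _ H] := xy.
have := H 2 (fun i => if i == 0 then u else - u')
            (fun i => if i == 0 then v else v').
rewrite !big_ord_recl !big_ord0 /= !addr0 -!/(tensor _ _ _) !tensorNl.
move=> h; split=> /eqP; rewrite -subr_eq0 => /eqP /h /eqP;
by rewrite subr_eq0 => /eqP.
Qed.

Lemma bilin_eq_cyclic i0 : cyclic y i0 -> cyclic x i0.
Proof.
have [H _ _] := xy.
move=> cyc u; have [s es] := cyc u; exists s.
apply/eqP; rewrite -subr_eq0 -linearZ -raddfB; apply/eqP; apply/H.
by rewrite linearB linearZ /= es subrr.
Qed.

Lemma bilin_eq_slice_onto i0 : slice_onto y i0 -> slice_onto x i0.
Proof.
move=> so u v; have [w ew] := so u v; exists w; exact/bilin_eq_tensor.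
Qed.

Lemma bilin_eq_noncommuting i0 i1 i2 :
  noncommuting y i0 i1 i2 -> noncommuting x i0 i1 i2.
Proof.
move=> [f [w [w' [e e' ne]]]]; exists f, w, w'.
split; [exact/bilin_eq_tensor|exact/bilin_eq_tensor|].
by apply: contra_not ne => /bilin_eq_tensor.
Qed.

Lemma bilin_eq_noncomm_onto i0 i1 i2 :
  noncomm_onto y i0 i1 i2 -> noncomm_onto x i0 i1 i2.
Proof.
by move=> [/bilin_eq_slice_onto so /bilin_eq_noncommuting nc]; split.
Qed.
End KernelInvariance.

Section Pull.
Variables (n d r1 r2 : nat) (A B : comNzRingType) (f : {rmorphism A -> B}).
Local Notation F := (map_mpoly f : {rmorphism {mpoly A[n]} -> {mpoly B[n]}}).
Variables (x : bilin n d r1 r2 A) (y : bilin n d r1 r2 B).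

(** Since [p1 y], [p2 y] and [p3 y] are onto, these two compatibilities already
    force the images of [g1] and [g3] to generate the modules over B. *)
Definition restricts
   (g1 : {linear M1 x -> M1 y | F \; *:%R})
   (g3 : {linear M3 x -> M3 y | F \; *:%R}) :=
  (forall u, g1 (p1 x u) = p1 y (map_mx F u)) /\
  (forall u v, g3 (tensor x u v) = tensor y (map_mx F u) (map_mx F v)).

Lemma bilin_pull_restricts : bilin_pull f x y ->
  exists g1 g3, restricts g1 g3.
Proof.
move=> [g1 [g2 [g3 [_ [e1 e2 e3]]]]]; exists g1, g3; split=> // u v.
by rewrite /tensor e3 e1 e2.
Qed.

Lemma map_delta r (i : 'I_r) :
  map_mx F (delta_mx 0 i : 'rV_r) = delta_mx 0 i.
Proof. by rewrite map_delta_mx. Qed.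

Variables (g1 : {linear M1 x -> M1 y | F \; *:%R})
          (g3 : {linear M3 x -> M3 y | F \; *:%R}).
Hypothesis (g : restricts g1 g3).

Lemma restricts_p1_span (Q : M1 y -> Prop) :
  Q 0 -> (forall a b, Q a -> Q b -> Q (a + b)) ->
  (forall i (s : {mpoly B[n]}), Q (s *: g1 (p1 x (delta_mx 0 i)))) ->
  forall m, Q m.
Proof.
move=> Q0 QD QT m; have [u <-] := p1_surj m.
rewrite (row_sum_delta u) linear_sum; elim/big_ind: _ => // i _.
by rewrite linearZ /=; have := QT i (u 0 i); rewrite (proj1 g) map_delta.
Qed.

Lemma restricts_spans : spans f g3.
Proof.
move=> Q Q0 QD QZ Qg; apply: tensor_basis_ind => // i j s.
by rewrite -!map_delta -(proj2 g); apply: reduce_span.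
Qed.
End Pull.

(** * Openness of the two conditions *)

(** [f] is the evaluation at a rational point, split by the constants [sigma]:
    so everything over B lifts to A, as the spreading lemmas require. *)
Section Spread.
Variables (n d r1 r2 : nat) (A B : comNzRingType) (Bf : is_field B).
Variable (f : {rmorphism A -> B}).
Local Notation F := (map_mpoly f : {rmorphism {mpoly A[n]} -> {mpoly B[n]}}).
Variables (x : bilin n d r1 r2 A) (y : bilin n d r1 r2 B).
Hypothesis (xy : bilin_pull f x y).
Variables (sigma : {rmorphism B -> A}) (sigmaK : cancel sigma f).

Lemma map_mpoly_section (s : {mpoly B[n]}) : F (map_mpoly sigma s) = s.
Proof. apply/mpolyP => m; rewrite !mcoeff_map_mpoly; exact: sigmaK. Qed.

Lemma map_mx_section r (u : 'rV[{mpoly B[n]}]_r) :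
  map_mx F (map_mx (map_mpoly sigma) u) = u.
Proof. by apply/rowP => i; rewrite !mxE map_mpoly_section. Qed.

Variables i0 i1 i2 : 'I_r1.
Local Notation e i := (delta_mx 0 i).

Lemma cyclic_spreads : cyclic y i0 ->
  exists h : A, f h != 0 /\
  forall (B' : comNzRingType) (B'f : is_field B') (f' : {rmorphism A -> B'})
    (y' : bilin n d r1 r2 B'),
  bilin_pull f' x y' -> f' h != 0 -> cyclic y' i0.
Proof.
move=> cyc; have [g1 [g3 [e1 _]]] := bilin_pull_restricts xy.
have [] := @spread_submodule A B Bf n d f _ _ g1 (M1_free x) (M1_free y)
  (fun m => exists s, m = s *: p1 x (e i0)).
- by exists 0; rewrite scale0r.
- by move=> _ _ [s ->] [t ->]; exists (s + t); rewrite scalerDl.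
- by move=> c _ [s ->]; exists (c%:MP * s); rewrite scalerA.
- move=> m'; have [u <-] := p1_surj m'; have [s ->] := cyc u.
  exists (map_mpoly sigma s *: p1 x (e i0)); split.
    by exists (map_mpoly sigma s).
  by rewrite reduceZ map_mpoly_section e1 map_delta.
move=> h [fh hP]; exists h; split=> // B' B'f f' y' pl f'h u.
have [g1' [g3' r]] := bilin_pull_restricts pl.
apply: (restricts_p1_span r (Q := fun m => exists s, m = s *: p1 y' (e i0))).
- by exists 0; rewrite scale0r.
- by move=> _ _ [s ->] [t ->]; exists (s + t); rewrite scalerDl.
move=> i s; have [j [t et]] := hP (p1 x (e i)).
have [b ba] := B'f _ (is_field_exp_neq0 B'f j f'h).
exists (s * (b%:MP * map_mpoly f' t)).
rewrite -scalerA; congr (_ *: _).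
rewrite -[LHS]scale1r -(rmorph1 (@mpolyC n _)) -ba rmorphM -!scalerA.
congr (_ *: _); rewrite -rmorphXn -reduceC et reduceZ.
by rewrite (proj1 r) map_delta.
Qed.

Lemma slice_onto_spreads : slice_onto y i0 ->
  exists h : A, f h != 0 /\
  forall m : M3 x, exists j w, (h ^+ j)%:MP *: m = tensor x (e i0) w.
Proof.
move=> so; have [g1 [g3 [_ e3]]] := bilin_pull_restricts xy.
have [] := @spread_submodule A B Bf n d f _ _ g3 (M3_free x) (M3_free y)
  (fun m => exists w, m = tensor x (e i0) w).
- by exists 0; rewrite tensor0r.
- by move=> _ _ [s ->] [t ->]; exists (s + t); rewrite tensorDr.
- by move=> c _ [s ->]; exists (c%:MP *: s); rewrite tensorZr.
- move=> m'; have [m <-] := slice_surj so m'; have [w <-] := p2_surj m.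
  exists (tensor x (e i0) (map_mx (map_mpoly sigma) w)); split.
    by exists (map_mx (map_mpoly sigma) w).
  by rewrite e3 map_delta map_mx_section.
by move=> h [fh hP]; exists h.
Qed.

(** Solutions w, w' of the two equations at the point need not extend to the
    family, but where T(e0, -) is onto, the equations can be solved in the
    family after multiplication by a power of [h]. This gives an element [z] of
    M3 whose value at any point is the commutator defect there, and z being
    nonzero is an open condition. *)
Lemma noncomm_onto_spreads : noncomm_onto y i0 i1 i2 ->
  exists h : A, f h != 0 /\
  forall (B' : comNzRingType) (B'f : is_field B') (f' : {rmorphism A -> B'})
    (y' : bilin n d r1 r2 B'),
  bilin_pull f' x y' -> f' h != 0 -> noncomm_onto y' i0 i1 i2.
Proof.
move=> [so [v [w [w' [ew ew' ne]]]]].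
have [g1 [g3 [e1 e3]]] := bilin_pull_restricts xy.
have [h [fh hP]] := slice_onto_spreads so.
pose v0 := map_mx (map_mpoly sigma) v.
have v0E : map_mx F v0 = v by exact: map_mx_section.
have [j1 [w1 ew1]] := hP (tensor x (e i1) v0).
have [j2 [w2 ew2]] := hP (tensor x (e i2) v0).
(* One common power J for both equations; W and W' absorb the difference. *)
pose J := (j1 + j2)%N.
pose V : 'rV[{mpoly A[n]}]_r2 := (h ^+ J)%:MP *: v0.
pose W : 'rV[{mpoly A[n]}]_r2 := (h ^+ j2)%:MP *: w1.
pose W' : 'rV[{mpoly A[n]}]_r2 := (h ^+ j1)%:MP *: w2.
have eW : tensor x (e i1) V = tensor x (e i0) W.
  rewrite /V /W !tensorZr -ew1 scalerA -rmorphM; congr (_%:MP *: _).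
  by rewrite -exprD addnC.
have eW' : tensor x (e i2) V = tensor x (e i0) W'.
  rewrite /V /W' !tensorZr -ew2 scalerA -rmorphM; congr (_%:MP *: _).
  by rewrite -exprD.
pose z := tensor x (e i2) W - tensor x (e i1) W'.
have FV : map_mx F V = (f h ^+ J)%:MP *: v.
  rewrite -v0E; apply/rowP => i; rewrite !mxE rmorphM /= map_mpolyC.
  by congr (_%:MP * _); exact: rmorphXn.
have FW : p2 y (map_mx F W) = (f h ^+ J)%:MP *: p2 y w.
  apply: (slice_inj Bf so).
  transitivity ((f h ^+ J)%:MP *: tensor y (e i1) v); last first.
    by rewrite ew linearZ.
  by rewrite -tensorZr -FV -(map_delta n f i1) -e3 eW e3 map_delta.
have FW' : p2 y (map_mx F W') = (f h ^+ J)%:MP *: p2 y w'.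
  apply: (slice_inj Bf so).
  transitivity ((f h ^+ J)%:MP *: tensor y (e i2) v); last first.
    by rewrite ew' linearZ.
  by rewrite -tensorZr -FV -(map_delta n f i2) -e3 eW' e3 map_delta.
have gz : g3 z != 0.
  rewrite linearB /= !e3 !map_delta /tensor FW FW' -!linearZ.
  rewrite -!/(tensor _ _ _) !tensorZr -scalerBr.
  have [b bh] := Bf (is_field_exp_neq0 Bf J fh).
  apply/eqP => /(congr1 (fun m => b%:MP *: m)).
  rewrite scalerA -rmorphM bh rmorph1 scale1r scaler0 => /eqP.
  by rewrite subr_eq0 => /eqP.
have [h' [fh' zP]] := spread_nonzero Bf (M3_free x) gz.
exists (h * h'); split; first by rewrite rmorphM is_field_mul_neq0.
move=> B' B'f f' y' pl; rewrite rmorphM => f'hh.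
have f'h : f' h != 0 by apply: contraNneq f'hh => ->; rewrite mul0r.
have f'h' : f' h' != 0 by apply: contraNneq f'hh => ->; rewrite mulr0.
have [g1' [g3' r]] := bilin_pull_restricts pl.
have e3' := proj2 r.
split.
  suff H m : exists w, m = tensor y' (e i0) w by move=> *; exact: H.
  elim/(restricts_spans r): m => [|a b [s ->] [t ->]|c a [s ->]|m].
  - by exists 0; rewrite tensor0r.
  - by exists (s + t); rewrite tensorDr.
  - by exists (c%:MP *: s); rewrite tensorZr.
  have [j [u eu]] := hP m.
  have [b bh] := B'f _ (is_field_exp_neq0 B'f j f'h).
  exists (b%:MP *: map_mx (map_mpoly f') u).
  rewrite tensorZr -(map_delta n f' i0) -e3' -eu reduceC scalerA -rmorphM.
  by rewrite rmorphXn bh rmorph1 scale1r.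
exists (map_mx (map_mpoly f') V), (map_mx (map_mpoly f') W),
  (map_mx (map_mpoly f') W').
rewrite -!(map_delta n f') -!e3' eW eW'; split=> // ez.
have := zP B' B'f f' _ g3' (M3_free y') (restricts_spans r) f'h'.
by rewrite linearB /= ez subrr eqxx.
Qed.
End Spread.

(** * A cyclic triple *)

(** Restriction of scalars *)
Definition restrict (S R : nzRingType) (phi : S -> R) (V : Type) : Type := V.

Section Restrict.
Variables (S R : nzRingType) (phi : {rmorphism S -> R}) (V : lmodType R).
Local Notation L := (restrict phi V).
HB.instance Definition _ := GRing.Zmodule.on L.
Definition restrict_scale (s : S) (v : L) : L := phi s *: (v : V).
Lemma restrict_scaleA a b v :
  restrict_scale a (restrict_scale b v) = restrict_scale (a * b) v.
Proof. by rewrite /restrict_scale rmorphM scalerA. Qed.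
Lemma restrict_scale1 : left_id 1 restrict_scale.
Proof. by move=> v; rewrite /restrict_scale rmorph1 scale1r. Qed.
Lemma restrict_scaleDr : right_distributive restrict_scale +%R.
Proof. by move=> a u v; rewrite /restrict_scale scalerDr. Qed.
Lemma restrict_scaleDl v : {morph restrict_scale^~ v : a b / a + b}.
Proof. by move=> a b; rewrite /restrict_scale rmorphD scalerDl. Qed.
HB.instance Definition _ := GRing.Zmodule_isLmodule.Build S L
  restrict_scaleA restrict_scale1 restrict_scaleDr restrict_scaleDl.
Lemma restrictE (s : S) (v : L) : s *: v = phi s *: (v : V) :> V.
Proof. by []. Qed.
End Restrict.

Lemma free_locally_free (A : comNzRingType) n d (M : lmodType {mpoly A[n]})
  (e : 'I_d -> M) : generates e -> independent e -> locally_free d M.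
Proof.
move=> ge ie P [_ _ _ P1 _]; exists 1, e; split=> // [m|c c0].
  by have [c ->] := ge m; exists 0%N, c; rewrite expr0 rmorph1 scale1r.
by exists 0%N => i; rewrite (ie c c0) mulr0.
Qed.

(** All three modules are A[t]/(t^d), with every variable acting as t, and p3 is
    the multiplication. *)
Section CyclicTriple.
Variables (A : comNzRingType) (n d r1 r2 : nat).
Hypothesis (d0 : (0 < d)%N).
Variables (l : 'I_n) (i0 : 'I_r1) (j0 : 'I_r2).
Local Notation S := {mpoly A[n]}.
Local Notation R := {poly %/ ('X^d : {poly A})}.

Definition to_poly : {rmorphism S -> {poly A}} :=
  mmap (@polyC A) (fun _ : 'I_n => 'X).
Definition to_trunc : {rmorphism S -> R} := in_qpoly 'X^d \o to_poly.

Lemma to_poly_surj (p : {poly A}) :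
  to_poly (\sum_(i < size p) (p`_i)%:MP * 'X_l ^+ i) = p.
Proof.
rewrite rmorph_sum -[RHS]coefK poly_def; apply: eq_bigr => i _.
by rewrite rmorphM rmorphXn /= mmapC mmapX mmap1U mul_polyC.
Qed.

Lemma size_modulus : (size (mk_monic ('X^d : {poly A}))).-1 = d.
Proof. by rewrite mk_monic_Xn size_polyXn; case: d d0. Qed.

Lemma in_qpolyK (r : R) : in_qpoly 'X^d (r : {poly A}) = r.
Proof. by apply: val_inj; apply: in_qpoly_small; exact: size_mk_monic. Qed.

Lemma to_trunc_surj (r : R) : exists s : S, to_trunc s = r.
Proof.
have := to_poly_surj (r : {poly A}); set s := \sum_(i < _) _ => es.
by exists s; rewrite /to_trunc /= es in_qpolyK.
Qed.

Definition trunc_mod : lmodType S := restrict to_trunc R^o.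

Definition trunc_basis (i : 'I_d) : trunc_mod := in_qpoly 'X^d 'X^i.

Lemma trunc_comb (c : 'I_d -> A) :
  \sum_i (c i)%:MP *: trunc_basis i = in_qpoly 'X^d (rVpoly (\row_i c i)) :> R.
Proof.
rewrite /rVpoly poly_def rmorph_sum; apply: eq_bigr => i _.
rewrite valK mxE -mul_polyC rmorphM.
by rewrite restrictE /to_trunc /= mmapC.
Qed.

Lemma trunc_locally_free : locally_free d trunc_mod.
Proof.
apply: (@free_locally_free _ _ _ _ trunc_basis) => [m|c c0 i].
  exists (fun i : 'I_d => ((m : R) : {poly A})`_i).
  rewrite [RHS]trunc_comb -[LHS]in_qpolyK; congr in_qpoly.
  have sm : (size ((m : R) : {poly A}) <= d)%N.
    by rewrite -[leqRHS]size_modulus size_npoly.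
  rewrite -[LHS](poly_rV_K sm).
  by congr rVpoly; apply/rowP => i; rewrite !mxE.
have sp : (size (rVpoly (\row_i c i)) <
           size (mk_monic ('X^d : {poly A})))%N.
  rewrite (leq_ltn_trans (size_poly _ _)) // -[ltnLHS]size_modulus.
  by rewrite prednK // size_mk_monic_gt0.
have := in_qpoly_small sp; rewrite -trunc_comb c0 => /esym /polyP /(_ i).
by rewrite coef_rVpoly_ord mxE coef0.
Qed.

Definition trunc_proj r (i : 'I_r) (u : 'rV[S]_r) : trunc_mod :=
  to_trunc (u 0 i).
Lemma trunc_proj_linear r (i : 'I_r) : linear (trunc_proj i).
Proof. by move=> s u v; rewrite /trunc_proj !mxE rmorphD rmorphM. Qed.
HB.instance Definition _ r (i : 'I_r) :=
  GRing.isLinear.Build S 'rV[S]_r trunc_mod _ (trunc_proj i)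
    (trunc_proj_linear i).

Definition trunc_mul (a b : trunc_mod) : trunc_mod := (a : R) * (b : R).
Lemma trunc_mul_bilinear : bilinear_for
  (GRing.Scale.Law.clone _ _ *:%R _) (GRing.Scale.Law.clone _ _ *:%R _)
  trunc_mul.
Proof.
split=> [b s a a'|a s b b']; rewrite /trunc_mul.
  by rewrite mulrDl; congr (_ + _); exact: (esym (@mulrA R _ _ _)).
by rewrite mulrDr; congr (_ + _); exact: (@mulrCA R).
Qed.
HB.instance Definition _ := bilinear_isBilinear.Build S trunc_mod trunc_mod
  trunc_mod *:%R *:%R trunc_mul trunc_mul_bilinear.

Lemma trunc_proj_surj r (i : 'I_r) m : exists u, trunc_proj i u = m.
Proof.
have [s <-] := to_trunc_surj m; exists (s *: delta_mx 0 i).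
by rewrite /trunc_proj !mxE !eqxx mulr1.
Qed.

Lemma trunc_mul_surj m : exists (N : nat) (u v : 'I_N -> trunc_mod),
  \sum_(i < N) trunc_mul (u i) (v i) = m.
Proof.
exists 1%N, (fun=> 1 : R), (fun=> m).
by rewrite big_ord1 /trunc_mul mul1r.
Qed.

Definition cyclic_triple : bilin n d r1 r2 A :=
  @BilinTriple n d r1 r2 A trunc_mod trunc_mod trunc_mod (trunc_proj i0)
    (trunc_proj j0) trunc_mul trunc_locally_free trunc_locally_free
    trunc_locally_free (@trunc_proj_surj _ i0) (@trunc_proj_surj _ j0)
    trunc_mul_surj.

Lemma cyclic_triple_cyclic : cyclic cyclic_triple i0.
Proof.
move=> u; exists (u 0 i0).
by rewrite -linearZ /= /trunc_proj !mxE !eqxx mulr1.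
Qed.
End CyclicTriple.

(** * A noncommuting triple *)

(** All three modules are A^d with the variables acting by zero. The action then
    imposes nothing on p3, and its slices can be taken to be the identity and
    two matrix units E_01, E_10 that do not commute: three indices a0, a1, a2,
    hence d >= 3, are needed for these slices to be independent. *)
Section NoncommutingTriple.
Variables (A : comNzRingType) (n d r1 r2 : nat).
Hypotheses (h1 : (d <= r1)%N) (h2 : (d <= r2)%N).
Variables (a0 a1 a2 : 'I_d).
Hypotheses (a01 : a0 != a1) (a02 : a0 != a2) (a12 : a1 != a2).
Local Notation S := {mpoly A[n]}.

Definition at_origin : {rmorphism S -> A} := meval (fun _ : 'I_n => 0).
Definition origin_mod : lmodType S := restrict at_origin 'rV[A]_d.

Lemma origin_comb (c : 'I_d -> A) :
  \sum_i (c i)%:MP *: (delta_mx 0 i : origin_mod) = \row_i c i :> 'rV_d.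
Proof.
rewrite [RHS]row_sum_delta; apply: eq_bigr => i _.
by rewrite restrictE mxE /at_origin /= mevalC.
Qed.

Lemma origin_locally_free : locally_free d origin_mod.
Proof.
apply: (@free_locally_free _ _ _ _ (fun i => delta_mx 0 i : origin_mod)).
  move=> m; exists (fun i => (m : 'rV_d) 0 i); rewrite [RHS]origin_comb.
  by apply/rowP => i; rewrite mxE.
move=> c c0 i; have := origin_comb c; rewrite c0 => /rowP /(_ i).
by rewrite !mxE.
Qed.

Definition origin_proj r (u : 'rV[S]_r) : origin_mod :=
  map_mx at_origin u *m (pid_mx d : 'M_(r, d)).
Lemma origin_proj_linear r : linear (@origin_proj r).
Proof.
move=> s u v; rewrite /origin_proj map_mxD mulmxDl; congr (_ + _).
by rewrite map_mxZ -scalemxAl.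
Qed.
HB.instance Definition _ r := GRing.isLinear.Build S 'rV[S]_r origin_mod _
  (@origin_proj r) (@origin_proj_linear r).

Lemma origin_proj_delta r (h : (d <= r)%N) (i : 'I_d) :
  origin_proj (delta_mx 0 (widen_ord h i)) = delta_mx 0 i.
Proof.
rewrite /origin_proj map_delta_mx -rowE; apply/rowP => j.
by rewrite !mxE eqxx /= ltn_ord andbT eq_sym.
Qed.

Lemma origin_proj_surj r (h : (d <= r)%N) m :
  exists u : 'rV_r, origin_proj u = m.
Proof.
exists (\sum_i ((m : 'rV_d) 0 i)%:MP *: delta_mx 0 (widen_ord h i)).
rewrite linear_sum [RHS](row_sum_delta (m : 'rV_d)); apply: eq_bigr => i _.
by rewrite linearZ [LHS]restrictE /= mevalC origin_proj_delta.
Qed.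

Definition act (v : 'rV[A]_d) : 'M[A]_d :=
  v 0 a0 *: 1%:M + v 0 a1 *: delta_mx a0 a1 + v 0 a2 *: delta_mx a1 a0.

Lemma act_linear : linear act.
Proof.
by move=> s u v; apply/matrixP => i j; rewrite !mxE; ring.
Qed.
HB.instance Definition _ :=
  GRing.isLinear.Build A 'rV[A]_d 'M[A]_d _ act act_linear.

Definition origin_mul (a b : origin_mod) : origin_mod :=
  (b : 'rV_d) *m act (a : 'rV_d).
Lemma origin_mul_bilinear : bilinear_for
  (GRing.Scale.Law.clone _ _ *:%R _) (GRing.Scale.Law.clone _ _ *:%R _)
  origin_mul.
Proof.
split=> [b s a a'|a s b b']; rewrite /origin_mul.
  have -> : act (s *: a + a') = at_origin s *: act a + act a'.
    by rewrite [LHS]linearD; congr (_ + _); exact: linearZ.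
  by rewrite mulmxDr -scalemxAr.
by rewrite mulmxDl; congr (_ + _); rewrite restrictE -scalemxAl.
Qed.
HB.instance Definition _ := bilinear_isBilinear.Build S origin_mod origin_mod
  origin_mod *:%R *:%R origin_mul origin_mul_bilinear.

Lemma act0 : act (delta_mx 0 a0) = 1%:M.
Proof.
rewrite /act !mxE !eqxx (eq_sym a1) (eq_sym a2) (negPf a01) (negPf a02) /=.
by rewrite scale1r !scale0r !addr0.
Qed.
Lemma act1 : act (delta_mx 0 a1) = delta_mx a0 a1.
Proof.
rewrite /act !mxE !eqxx (eq_sym a2) (negPf a01) (negPf a12) /=.
by rewrite scale1r !scale0r !addr0 add0r.
Qed.
Lemma act2 : act (delta_mx 0 a2) = delta_mx a1 a0.
Proof.
rewrite /act !mxE !eqxx (negPf a02) (negPf a12) /=.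
by rewrite scale1r !scale0r !add0r.
Qed.

Lemma origin_mul_surj m : exists (N : nat) (u v : 'I_N -> origin_mod),
  \sum_(i < N) origin_mul (u i) (v i) = m.
Proof.
exists 1%N, (fun=> delta_mx 0 a0), (fun=> m).
by rewrite big_ord1 /origin_mul act0 mulmx1.
Qed.

Definition origin_triple : bilin n d r1 r2 A :=
  @BilinTriple n d r1 r2 A origin_mod origin_mod origin_mod (@origin_proj r1)
    (@origin_proj r2) origin_mul origin_locally_free origin_locally_free
    origin_locally_free (@origin_proj_surj r1 h1) (@origin_proj_surj r2 h2)
    origin_mul_surj.

Local Notation i0 := (widen_ord h1 a0).
Local Notation i1 := (widen_ord h1 a1).
Local Notation i2 := (widen_ord h1 a2).

Lemma origin_tensor (u : 'rV[S]_r1) (v : 'rV[S]_r2) :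
  tensor origin_triple u v = origin_proj v *m act (origin_proj u) :> 'rV_d.
Proof. by []. Qed.

Lemma origin_triple_noncomm : noncomm_onto origin_triple i0 i1 i2.
Proof.
split=> [u v|].
  have [w ew] := origin_proj_surj h2 (tensor origin_triple u v).
  by exists w; rewrite -ew [RHS]origin_tensor origin_proj_delta act0 mulmx1.
exists (delta_mx 0 (widen_ord h2 a0)), (delta_mx 0 (widen_ord h2 a1)), 0.
split.
- rewrite [LHS]origin_tensor [RHS]origin_tensor !origin_proj_delta.
  by rewrite act0 act1 mulmx1 mul_delta_mx.
- rewrite [LHS]origin_tensor [RHS]origin_tensor !origin_proj_delta.
  by rewrite act2 mul_delta_mx_0 // linear0 mul0mx.
rewrite tensor0r => /(congr1 (fun m : 'rV[A]_d => m 0 a0)) /eqP.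
rewrite (congr1 (fun m : 'rV[A]_d => m 0 a0) (origin_tensor _ _)).
rewrite !origin_proj_delta act2.
by rewrite mul_delta_mx !mxE !eqxx oner_eq0.
Qed.
End NoncommutingTriple.

(** * Two disjoint open loci *)

Lemma inv_at_open (X : ringedSpace) (U : opens X) (s : sec U) :
  open [set x : X | inv_at x s].
Proof.
have -> : [set x : X | inv_at x s] =
  \bigcup_(V in [set V : opens X |
    exists (h : V `<=` U) (t : sec V), t * res h s = 1]) V.
  apply/seteqP; split=> [x [V [h [t [Vx e]]]]|x [V [h [t e]] Vx]].
    by exists V => //; exists h, t.
  by exists V, h, t.
by apply: bigcup_open => V _; exact: oset_open.
Qed.

Lemma algebra_of_field (k K : fieldType) (phi : {rmorphism k -> K}) :
  is_field (algebra_of (oner_neq0 K) phi).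
Proof. by move=> b b0; exists ((b : K)^-1); exact: mulVf. Qed.

Lemma irreducible_meet (X : topologicalType) (O O' : set X) :
  irreducible_space X -> open O -> open O' -> O !=set0 -> O' !=set0 ->
  exists x, O x /\ O' x.
Proof.
move=> [_ irr] oO oO' [x Ox] [x' Ox']; apply: contrapT => none.
have [||||] := irr (~` O) (~` O'); rewrite ?closedC //.
- apply/seteqP; split=> // z _; apply: contrapT.
  by move=> /not_orP[/contrapT Oz /contrapT Oz']; apply: none; exists z.
- by move=> e; have : (~` O) x by rewrite e.
- by move=> e; have : (~` O') x' by rewrite e.
Qed.

Section OpenLocus.
Variables (k : fieldType) (n d r1 r2 : nat) (X : scheme k).
Variable Phi : forall (A : comAlgType k) (T : scheme k),
  spec_of A T -> hom T X -> bilin n d r1 r2 A.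
Hypothesis Phi_surj : forall A T (i : spec_of A T) (x : bilin n d r1 r2 A),
  exists u : hom T X, bilin_eq (Phi i u) x.
Hypothesis Phi_nat :
  forall (A B : comAlgType k) T T' (i : spec_of A T) (j : spec_of B T')
    (f : {lrmorphism A -> B}) (g : hom T' T)
    (h : full T' `<=` preim (hcont g) (full T)),
    (forall a : A, res h (sharp g (full T) (i a)) = j (f a)) ->
    forall u : hom T X,
      bilin_pull f (Phi i u) (Phi j (comp_hom u g)).

Variable P : forall A : comNzRingType, bilin n d r1 r2 A -> Prop.
Hypothesis P_eq : forall A (x y : bilin n d r1 r2 A),
  bilin_eq x y -> P y -> P x.
Hypothesis P_spreads : forall (A B : comNzRingType) (f : {rmorphism A -> B})
  (sigma : {rmorphism B -> A}) (x : bilin n d r1 r2 A) (y : bilin n d r1 r2 B),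
  is_field B -> cancel sigma f -> bilin_pull f x y -> P y ->
  exists h : A, f h != 0 /\
  forall (B' : comNzRingType), is_field B' ->
  forall (f' : {rmorphism A -> B'}) (y' : bilin n d r1 r2 B'),
  bilin_pull f' x y' -> f' h != 0 -> P y'.
Hypothesis P_point : forall A : comNzRingType,
  exists y : bilin n d r1 r2 A, P y.

(** A condition that spreads from a rational point to a neighbourhood and holds
    for some triple over k holds on a nonempty open subset of X: spread it out
    in the universal family over an affine neighbourhood of the point that
    represents the triple. *)
Lemma open_locus : exists O : set X, [/\ open O, O !=set0 &
  forall (K : fieldType) (phi : {rmorphism k -> K}) (u : hom (pt_scheme phi) X),
    O (u tt) -> P (Phi (pt_spec phi) u)].
Proof.
pose phi : {rmorphism k -> k} := idfun.
have [y Py] := P_point (algebra_of (oner_neq0 k) phi).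
have [u uy] := Phi_surj (pt_spec phi) y.
have [U [Ux Uaff]] := scheme_affine (u tt).
have nz : 1 != 0 :> sec U.
  apply/eqP => e; have [+ _] := scheme_lr Ux; apply; rewrite -e.
  by exists U, (fun _ => id), 1; rewrite rmorph1 mulr1.
have [Y YP] := @universal_family k X _
  (fun A B f => @bilin_pull n d r1 r2 A B f) Phi Phi_nat U Uaff nz.
(* Constants split the evaluation of functions at a k-point. *)
pose sigma : {rmorphism algebra_of (oner_neq0 k) phi ->
                        algebra_of nz (aff_str U)} := aff_str U.
have sK : cancel sigma (@pt_value _ _ _ nz _ _ _ Ux).
  by move=> c; exact: pt_value_str.
have [h [uh hP]] :=
  P_spreads (@algebra_of_field k k phi) sK (YP _ _ u Ux) (P_eq uy Py).
exists (U `&` [set x : X | inv_at x (h : sec U)]); split.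
- by apply: openI; [exact: oset_open|exact: inv_at_open].
- by exists (u tt); split=> //; apply/(pt_value_inv nz Ux h).
move=> K psi v [Uv /(pt_value_inv nz Uv) vh].
exact: (hP _ (@algebra_of_field k K psi) _ _ (YP _ _ v Uv) vh).
Qed.
End OpenLocus.

Close Scope ring_scope.
Close Scope classical_set_scope.

Theorem theorem3p18 (k : closedFieldType) (n d r1 r2 : nat) :
  1 <= n -> d <= r1 -> d <= r2 -> 3 <= d -> n < d ^ 2 - 3 * d + 2 ->
  forall X : scheme k, represents_bilin n d r1 r2 X -> ~ irreducible_space X.
Proof.
move=> n1 dr1 dr2 d3 _ X [Phi [_ Psurj Pnat]] Xirr.
have d0 : 0 < d by apply: leq_trans d3.
have d1 : 1 < d by apply: leq_trans d3.
pose a0 := Ordinal d0; pose a1 := Ordinal d1; pose a2 := Ordinal d3.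
pose i0 := widen_ord dr1 a0; pose i1 := widen_ord dr1 a1.
pose i2 := widen_ord dr1 a2.
pose j0 := widen_ord dr2 a0.
have [|||O [oO O0 OP]] :=
    @open_locus k n d r1 r2 X Phi Psurj Pnat (fun A y => cyclic y i0).
- by move=> A y y' /bilin_eq_cyclic; apply.
- move=> A B f s y y' Bf sK pl; exact (cyclic_spreads Bf pl sK (i0 := i0)).
- by move=> A; eexists; exact: cyclic_triple_cyclic d0 (Ordinal n1) i0 j0.
have [|||O' [oO' O'0 O'P]] :=
    @open_locus k n d r1 r2 X Phi Psurj Pnat
      (fun A y => noncomm_onto y i0 i1 i2).
- by move=> A y y' /bilin_eq_noncomm_onto; apply.
- move=> A B f s y y' Bf sK pl.
  exact (noncomm_onto_spreads Bf pl sK (i0 := i0) (i1 := i1) (i2 := i2)).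
- by move=> A; eexists; exact: origin_triple_noncomm.
(* A common point of the two loci, seen over its residue field, would satisfy
   both conditions. *)
have [x [Ox O'x]] := irreducible_meet Xirr oO oO' O0 O'0.
have [K [phi [u ux]]] := ex_residue_point x.
have cyc := OP K phi u; have := O'P K phi u; rewrite ux => /(_ O'x)[so nc].
apply: cyclic_not_noncommuting so nc; first exact: algebra_of_field.
by apply: cyc; rewrite ux.
Qed.
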